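(* Let $\Psi$, $m$, $\Psi^m$, $\rho_g^m<\rho_\ell^m$ and $p$ be as in the context. Let $\varepsilon(\rho)=\varepsilon$ be a positive constant and $\bar\mu=0$. Let $\rho_*\in(\rho_g^m,\rho_\ell^m)$. Then there exists a constant $\varepsilon_0>0$ (not depending on $\varepsilon$ or $\omega$) such that for any $\omega>0$ with $\varepsilon/\omega^2<\varepsilon_0$ there exists a non-constant periodic solution $\rho_\varepsilon$, with period $\omega$, of $$\partial_x\!\left(\frac{m^2}{\rho}\right)+\partial_x\big(p(\rho)\big)-\partial_x\big(\bar\mu\,\partial_x u\big)=\rho\,\partial_x\big(\varepsilon\,\partial_x^2\rho\big)\quad\text{in }\mathbb{R},\qquad u=\frac m\rho,\quad m\text{ constant},$$ (with $\bar\mu=0$) satisfying $$\frac1\omega\int_0^\omega\rho_\varepsilon\,dx=\rho_* .$$ Moreover, the values of $\rho_\varepsilon$ lie in $[\rho_g^m,\rho_\ell^m]$. Furthermore, for fixed $\omega$ one can take the $\rho_\varepsilon$ so that, as $\varepsilon\downarrow0$, $\rho_\varepsilon$ converges in $L^1(\mathbb{R}/\omega\mathbb{Z})$ to a function with values in $\{\rho_g^m,\rho_\ell^m\}$ having exactly two jumps (on $\mathbb{R}/\omega\mathbb{Z}$). In the case $m\ne0$, the velocity $u_\varepsilon=m/\rho_\varepsilon$ is not a constant function. If $\bar\mu>0$ instead of $\bar\mu=0$, such a solution $\rho_\varepsilon$ still exists if $m=0$, with constant $u_\varepsilon$.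
   Context: These are the stationary one-dimensional isothermal Euler-Korteweg ($\bar\mu=0$) or Navier-Stokes-Korteweg ($\bar\mu=\bar\mu(\rho)>0$) equations, in which $\rho>0$ is the density, $m$ the (constant) momentum, $u=m/\rho$ the velocity. Standing assumptions. The volume specific available energy $\Psi=\Psi(\rho)$ is $C^2$ for $\rho>0$, and the pressure is $p(\rho)=\rho\Psi'(\rho)-\Psi(\rho)$. There are two points $\rho_\ell>\rho_g>0$ such that the graph of $\Psi$ has a bitangent line through $(\rho_g,\Psi(\rho_g))$ and $(\rho_\ell,\Psi(\rho_\ell))$ (a line tangent to the graph at both points), and in some neighborhood of $[\rho_g,\rho_\ell]$ the graph of $\Psi$ lies strictly above this line except at $\rho_g$ and $\rho_\ell$. For a constant $m\in\mathbb{R}$ set $\Psi^m(\rho)=\Psi(\rho)-\frac{m^2}{2\rho}$. The constant $m$ is assumed to be such that $\Psi^m$ has the same property with $\rho_g,\rho_\ell$ replaced by some $\rho_g^m<\rho_\ell^m$ (both positive; $\rho_g^0=\rho_g$, $\rho_\ell^0=\rho_\ell$), i.e. the graph of $\Psi^m$ has a bitangent line at $\rho_g^m$ and $\rho_\ell^m$ and lies strictly above it in a neighborhood of $[\rho_g^m,\rho_\ell^m]$ except at these two points; this holds when $|m|$ is sufficiently small. *)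

(* Defs.v *)
From Stdlib Require Import Reals.
From Coquelicot Require Import Coquelicot.
Open Scope R_scope.

(* [f] is of class C^k on the open set [D].  [Derive_n] is total, so
   differentiability has to be required at every order up to [k]. *)
Definition Ck_on (k : nat) (D : R -> Prop) (f : R -> R) : Prop :=
  (forall j x, (j <= k)%nat -> D x -> ex_derive_n f j x) /\
  (forall x, D x -> continuous (Derive_n f k) x).

Definition pressure (Psi : R -> R) (r : R) : R := r * Derive Psi r - Psi r.

Definition Psim (Psi : R -> R) (m : R) (r : R) : R := Psi r - m ^ 2 / (2 * r).

(* The line [t |-> alpha + beta * t] is tangent to the graph of [f] at both
   [a] and [b]; elsewhere on a neighbourhood of [[a, b]] the graph lies
   strictly above it. *)
Definition strict_bitangent (f : R -> R) (a b : R) : Prop :=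
  exists alpha beta : R,
    f a = alpha + beta * a /\ is_derive f a beta /\
    f b = alpha + beta * b /\ is_derive f b beta /\
    exists d : R, 0 < d /\
      forall r, a - d < r < b + d -> r <> a -> r <> b -> alpha + beta * r < f r.

Definition is_constant (f : R -> R) : Prop := exists c, forall x, f x = c.

Definition periodic (omega : R) (f : R -> R) : Prop :=
  forall x, f (x + omega) = f x.

Definition velocity (m : R) (rho : R -> R) (x : R) : R := m / rho x.

(* Classical solutions.  The remaining derivatives in the equation exist by
   the first two conditions when [Psi] is C^2 on the positive half-line. *)
Definition steady_solution (Psi mu : R -> R) (eps m : R) (rho : R -> R) : Prop :=
  Ck_on 3 (fun _ => True) rho /\
  (forall x, 0 < rho x) /\
  (forall x, ex_derive (fun y => mu (rho y) * Derive (velocity m rho) y) x) /\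
  (forall x,
     Derive (fun y => m ^ 2 / rho y) x
     + Derive (fun y => pressure Psi (rho y)) x
     - Derive (fun y => mu (rho y) * Derive (velocity m rho) y) x
     = rho x * Derive (fun y => eps * Derive_n rho 2 y) x).

Definition periodic_profile (Psi mu : R -> R)
    (eps m omega rho_star rmin rmax : R) (rho : R -> R) : Prop :=
  steady_solution Psi mu eps m rho /\
  periodic omega rho /\
  ~ is_constant rho /\
  1 / omega * RInt rho 0 omega = rho_star /\
  (forall x, rmin <= rho x <= rmax).

Definition jump_at (f : R -> R) (x : R) : Prop :=
  exists l r : R, l <> r /\
    filterlim f (at_left x) (locally l) /\ filterlim f (at_right x) (locally r).

(* [[0, omega)] is the fundamental domain for R / omega Z; one-sided limits
   at 0 see the values near [omega] through periodicity. *)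
Definition exactly_two_jumps (omega : R) (f : R -> R) : Prop :=
  periodic omega f /\
  exists a b : R, 0 <= a /\ a < b /\ b < omega /\
    jump_at f a /\ jump_at f b /\
    (forall x, 0 <= x < omega -> x <> a -> x <> b -> continuous f x).

(* Convergence in L^1(R / omega Z) as eps decreases to 0.  Here the limit has
   finitely many discontinuities, so the Riemann integral suffices. *)
Definition L1_cvg (omega : R) (rho : R -> R -> R) (rho0 : R -> R) : Prop :=
  at_right 0 (fun eps => ex_RInt (fun x => Rabs (rho eps x - rho0 x)) 0 omega) /\
  filterlim (fun eps => RInt (fun x => Rabs (rho eps x - rho0 x)) 0 omega)
    (at_right 0) (locally 0).

Definition two_phase_limit (omega rmin rmax : R) (rho : R -> R -> R) : Prop :=
  exists rho0 : R -> R,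
    (forall x, rho0 x = rmin \/ rho0 x = rmax) /\
    exactly_two_jumps omega rho0 /\
    L1_cvg omega rho rho0.

(* Main.v *)
Require Import Defs.
From Stdlib Require Import Reals Lra Lia ClassicalEpsilon FunctionalExtensionality.
From Coquelicot Require Import Coquelicot.
Open Scope R_scope.

(** Because [m^2 / rho + p(rho)] has derivative [rho * (Psim'(rho))'], the
    inviscid equation integrates to [eps * rho'' = Psim'(rho) - const].
    Subtracting the bitangent line from [Psim] and clamping the density to
    [[a, b] = [rho_gm, rho_lm]] leaves a double well [F]: it vanishes outside
    [(a, b)], is positive inside, and its derivative [g] is globally Lipschitz
    ([bitangent_double_well]).  In the variable [y = x / sqrt eps] one looks for
    monotone solutions of [w'' = g(w) - lam] on [[0, K]],
    [K = omega / (2 * sqrt eps)], with [w' = 0] at both ends and mean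
    [rho_star], for every large [K] ([half_period_exists]).  Uniqueness for the
    initial value problem extends such a half period to an even function of
    period [2 * K].

    The half period is found by shooting.  Along a solution
    [w'^2 = 2 * (F(w) - l(w))], where the graph of [l] is a line of slope [lam].
    Fix [p < c < q] with [p] near [a] and [q] near [b], let [s] and [t] be the
    heights of the line at [p] and [q], and start at [c] with positive velocity.
    Let [T2] and [T1] be the first turning times forward and backward, truncated
    at [K].  No assumption restricts the critical points of [F] near the wells,
    so that the turning points jump as the line moves; but a turning point
    reached in finite time is never an equilibrium, so the truncated turning
    times are continuous in [(s, t)] ([exit_time_stable], [shot_stable]).  The
    points [p] and [q] minimise [F] tilted by a small slope, hence [F] grows at
    a definite rate from [p] and [q] towards [c], and [p], [q] are reached
    within a time that does not depend on [K] ([barrier_point], [ht_fast]).  If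
    the line is negative at [p], and no higher at [p] than at [q], the trajectory
    never turns on the left; if it meets [F] at [p], the trajectory turns there
    within that bounded time; likewise at [q].  The theorem of Poincare and
    Miranda on the rectangle of admissible [(s, t)] therefore gives a line for
    which the total time is [K] and the mean is [rho_star] ([balanced_shot]).
    The energy identity keeps the resulting solution within [[a, b]]
    ([shot_confined]).

    Up to a bounded time and a small multiple of [K], the half period stays near
    [a] or near [b], which gives the [L^1] limit with two jumps
    ([half_period_L1], [profile_family]).  When [m = 0] the velocity vanishes,
    and so does the viscous term. *)

(** * A Poincare-Miranda theorem in the plane *)

(** Oriented count of the edges whose endpoints carry the labels 0 and 1. *)
Definition edge01 (x y : nat) : Z :=
  match x, y with
  | 0%nat, 1%nat => 1%Z
  | 1%nat, 0%nat => (-1)%Z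
  | _, _ => 0%Z
  end.

(** Sum of [edge01] over the first [n] edges of a row of labels. *)
Fixpoint edge_sum (l : nat -> nat) (n : nat) : Z :=
  match n with
  | O => 0%Z
  | S k => (edge_sum l k + edge01 (l k) (l (S k)))%Z
  end.

(** [edge01] is closed on a triangle that misses one of the labels 0, 1, 2. *)
Lemma edge01_triangle (x y z : nat) :
  (x <= 2)%nat -> (y <= 2)%nat -> (z <= 2)%nat ->
  (exists k, (k <= 2)%nat /\ x <> k /\ y <> k /\ z <> k) ->
  (edge01 x y + edge01 y z = edge01 x z)%Z.
Proof.
intros Hx Hy Hz [k [Hk [H1 [H2 H3]]]].
destruct x as [|[|[|x]]]; try lia; destruct y as [|[|[|y]]]; try lia;
destruct z as [|[|[|z]]]; try lia; destruct k as [|[|[|k]]]; try lia; reflexivity.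
Qed.

(** If every unit square misses a label, the sum of [edge01] along a row does
    not depend on the row, because [edge01] is then closed on both triangles
    of every square and vanishes on the left and right sides. *)
Lemma sperner_square (n : nat) (lab : nat -> nat -> nat) :
  (forall i j, (lab i j <= 2)%nat) ->
  (forall j, lab 0%nat j = 0%nat) ->
  (forall j, lab n j <> 0%nat) ->
  (forall i, lab i 0%nat <> 2%nat) ->
  (forall i, lab i n <> 1%nat) ->
  exists i j, (i < n)%nat /\ (j < n)%nat /\
    forall k, (k <= 2)%nat ->
      lab i j = k \/ lab (S i) j = k \/ lab i (S j) = k \/ lab (S i) (S j) = k.
Proof.
intros Hlab HL HR HB HT.
apply NNPP; intros Hno.
assert (Hsq : forall i j, (i < n)%nat -> (j < n)%nat ->
   (edge01 (lab i j) (lab (S i) j) + edge01 (lab (S i) j) (lab (S i) (S j)) =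
    edge01 (lab i j) (lab i (S j)) + edge01 (lab i (S j)) (lab (S i) (S j)))%Z).
{ intros i j Hi Hj.
  assert (Hk : exists k, (k <= 2)%nat /\ lab i j <> k /\ lab (S i) j <> k /\
                lab i (S j) <> k /\ lab (S i) (S j) <> k).
  { apply NNPP; intros Hc. apply Hno. exists i, j. repeat split; auto.
    intros k Hk. apply NNPP; intros Hc2. apply Hc. exists k. tauto. }
  destruct Hk as [k [Hk [K1 [K2 [K3 K4]]]]].
  rewrite !edge01_triangle; auto; exists k; tauto. }
assert (Hrow : forall j, (j < n)%nat -> forall m, (m <= n)%nat ->
   (edge_sum (fun i => lab i j) m + edge01 (lab m j) (lab m (S j)) =
    edge_sum (fun i => lab i (S j)) m)%Z).
{ intros j Hj m; induction m as [|m IH]; intros Hm.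
  - simpl. rewrite !HL. reflexivity.
  - simpl. assert (H := Hsq m j ltac:(lia) Hj).
    assert (H2 := IH ltac:(lia)). lia. }
assert (Hcst : forall j, (j <= n)%nat ->
   edge_sum (fun i => lab i j) n = edge_sum (fun i => lab i 0%nat) n).
{ induction j as [|j IH]; intros Hj; auto.
  rewrite <- (IH ltac:(lia)). rewrite <- (Hrow j ltac:(lia) n (le_n n)).
  assert (H1 := HR j). assert (H2 := HR (S j)).
  destruct (lab n j) as [|[|k]]; try lia; destruct (lab n (S j)) as [|k']; try lia;
  destruct k'; simpl; lia. }
assert (Htop : forall m, edge_sum (fun i => lab i n) m = 0%Z).
{ induction m as [|m IH]; simpl; auto. rewrite IH.
  assert (H1 := HT m). assert (H2 := HT (S m)).
  destruct (lab m n) as [|[|a]]; destruct (lab (S m) n) as [|[|b]]; simpl; lia. }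
assert (Hbot : forall m, edge_sum (fun i => lab i 0%nat) m = Z.of_nat (lab m 0%nat)).
{ induction m as [|m IH]; simpl. { now rewrite HL. }
  rewrite IH.
  assert (H1 := HB m). assert (H2 := HB (S m)).
  assert (H3 := Hlab m 0%nat). assert (H4 := Hlab (S m) 0%nat).
  destruct (lab m 0%nat) as [|[|a]]; destruct (lab (S m) 0%nat) as [|[|b]]; simpl; try lia. }
assert (H := Hcst n (le_n n)). rewrite Htop, Hbot in H.
assert (H1 := HR 0%nat). lia.
Qed.

(** Continuity relative to a rectangle. *)
Definition continuous_in_rect (x0 x1 y0 y1 : R) (f : R -> R -> R) : Prop :=
  forall x y, x0 <= x <= x1 -> y0 <= y <= y1 ->
  forall e, 0 < e -> exists d, 0 < d /\
  forall x' y', x0 <= x' <= x1 -> y0 <= y' <= y1 ->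
    Rabs (x' - x) < d -> Rabs (y' - y) < d -> Rabs (f x' y' - f x y) < e.

Lemma grid_point_in (x0 x1 : R) (n k : nat) :
  x0 < x1 -> (k <= S n)%nat ->
  x0 <= x0 + INR k * ((x1 - x0) / INR (S n)) <= x1.
Proof.
intros Hx Hk.
assert (Hn : 0 < INR (S n)) by (apply lt_0_INR; lia).
assert (Hkn : INR k <= INR (S n)) by (apply le_INR; lia).
assert (0 <= INR k) by apply pos_INR.
set (h := (x1 - x0) / INR (S n)).
assert (Hh : 0 < h) by (apply Rdiv_lt_0_compat; lra).
assert (INR (S n) * h = x1 - x0) by (unfold h; field; lra).
nra.
Qed.

(** Label a grid point 0 if [f > 0], else 1 if [g > 0], else 2.  If [f] and [g]
    have no common zero, a fine enough grid has no square with all three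
    labels, since near every point [f] or [g] keeps its sign. *)
Theorem poincare_miranda (x0 x1 y0 y1 : R) (f g : R -> R -> R) :
  x0 < x1 -> y0 < y1 ->
  continuous_in_rect x0 x1 y0 y1 f -> continuous_in_rect x0 x1 y0 y1 g ->
  (forall y, y0 <= y <= y1 -> 0 < f x0 y) ->
  (forall y, y0 <= y <= y1 -> f x1 y < 0) ->
  (forall x, x0 <= x <= x1 -> 0 < g x y0) ->
  (forall x, x0 <= x <= x1 -> g x y1 < 0) ->
  exists x y, x0 <= x <= x1 /\ y0 <= y <= y1 /\ f x y = 0 /\ g x y = 0.
Proof.
intros Hx Hy Cf Cg fL fR gB gT.
apply NNPP; intros Hno.
set (good := fun u v d => 0 < d /\
  ((forall x y, x0 <= x <= x1 -> y0 <= y <= y1 ->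
     Rabs (x - u) < 2 * d -> Rabs (y - v) < 2 * d -> 0 < f x y) \/
   (forall x y, x0 <= x <= x1 -> y0 <= y <= y1 ->
     Rabs (x - u) < 2 * d -> Rabs (y - v) < 2 * d -> f x y < 0) \/
   (forall x y, x0 <= x <= x1 -> y0 <= y <= y1 ->
     Rabs (x - u) < 2 * d -> Rabs (y - v) < 2 * d -> 0 < g x y) \/
   (forall x y, x0 <= x <= x1 -> y0 <= y <= y1 ->
     Rabs (x - u) < 2 * d -> Rabs (y - v) < 2 * d -> g x y < 0))).
assert (Hgood : forall u v, x0 <= u <= x1 -> y0 <= v <= y1 -> exists d : posreal, good u v d).
{ intros u v Hu Hv.
  assert (Hs : forall h, continuous_in_rect x0 x1 y0 y1 h -> h u v <> 0 ->
     exists d, 0 < d /\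
     ((forall x y, x0 <= x <= x1 -> y0 <= y <= y1 ->
       Rabs (x - u) < 2 * d -> Rabs (y - v) < 2 * d -> 0 < h x y) \/
     (forall x y, x0 <= x <= x1 -> y0 <= y <= y1 ->
       Rabs (x - u) < 2 * d -> Rabs (y - v) < 2 * d -> h x y < 0))).
  { intros h Ch Hh.
    destruct (Ch u v Hu Hv (Rabs (h u v)) (Rabs_pos_lt _ Hh)) as [d [Hd Hd2]].
    exists (d / 2). split; [lra|].
    destruct (Rlt_or_le 0 (h u v)) as [Hp|Hp]; [left|right]; intros x y Hx' Hy' H1 H2;
    assert (H := Hd2 x y Hx' Hy' ltac:(lra) ltac:(lra)).
    - rewrite (Rabs_pos_eq (h u v)) in H by lra. apply Rabs_def2 in H. lra.
    - rewrite (Rabs_left (h u v)) in H by lra. apply Rabs_def2 in H. lra. }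
  destruct (Req_dec (f u v) 0) as [Ef|Nf].
  - destruct (Req_dec (g u v) 0) as [Eg|Ng].
    + exfalso; apply Hno. exists u, v. tauto.
    + destruct (Hs g Cg Ng) as [d [Hd H]]. exists (mkposreal d Hd). unfold good; simpl; tauto.
  - destruct (Hs f Cf Nf) as [d [Hd H]]. exists (mkposreal d Hd). unfold good; simpl; tauto. }
set (delta := fun u v => epsilon (inhabits (mkposreal 1 Rlt_0_1)) (fun d : posreal => good u v d)).
assert (Hdelta : forall u v, x0 <= u <= x1 -> y0 <= v <= y1 -> good u v (delta u v)).
{ intros u v Hu Hv. apply epsilon_spec. now apply Hgood. }
destruct (compactness_value_2d x0 x1 y0 y1 delta) as [d Hd].
(* a grid of mesh smaller than [d] *)
assert (Hmesh : exists n : nat, (x1 - x0) / INR (S n) < d /\ (y1 - y0) / INR (S n) < d).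
{ destruct (archimed_cor1 (d / ((x1 - x0) + (y1 - y0)))) as [N [HN HN0]].
  { apply Rdiv_lt_0_compat; [apply cond_pos|lra]. }
  exists (pred N). replace (S (pred N)) with N by lia.
  assert (0 < INR N) by (apply lt_0_INR; lia).
  assert (Hd' : ((x1 - x0) + (y1 - y0)) / INR N < d).
  { apply (Rmult_lt_compat_r ((x1 - x0) + (y1 - y0))) in HN; [|lra].
    replace (d / (x1 - x0 + (y1 - y0)) * (x1 - x0 + (y1 - y0))) with (pos d) in HN by (field; lra).
    unfold Rdiv. lra. }
  assert (0 < (x1 - x0) / INR N) by (apply Rdiv_lt_0_compat; lra).
  assert (0 < (y1 - y0) / INR N) by (apply Rdiv_lt_0_compat; lra).
  unfold Rdiv in *. rewrite Rmult_plus_distr_r in Hd'. lra. }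
destruct Hmesh as [n [Hmx Hmy]].
set (hx := (x1 - x0) / INR (S n)) in *. set (hy := (y1 - y0) / INR (S n)) in *.
assert (Hn : 0 < INR (S n)) by (apply lt_0_INR; lia).
assert (Hhx : 0 < hx) by (apply Rdiv_lt_0_compat; lra).
assert (Hhy : 0 < hy) by (apply Rdiv_lt_0_compat; lra).
set (px := fun i => x0 + INR (min i (S n)) * hx).
set (py := fun i => y0 + INR (min i (S n)) * hy).
assert (Hpx : forall i, x0 <= px i <= x1).
{ intros i. apply grid_point_in; auto. lia. }
assert (Hpy : forall i, y0 <= py i <= y1).
{ intros i. apply grid_point_in; auto. lia. }
assert (px0 : px 0%nat = x0) by (unfold px; simpl; lra).
assert (py0 : py 0%nat = y0) by (unfold py; simpl; lra).
assert (pxn : px (S n) = x1) by (unfold px; rewrite Nat.min_id; unfold hx; field; lra).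
assert (pyn : py (S n) = y1) by (unfold py; rewrite Nat.min_id; unfold hy; field; lra).
set (lab := fun i j => if Rlt_dec 0 (f (px i) (py j)) then 0%nat
                       else if Rlt_dec 0 (g (px i) (py j)) then 1%nat else 2%nat).
destruct (sperner_square (S n) lab) as [i [j [Hi [Hj Hk]]]].
- intros i j; unfold lab. destruct Rlt_dec; [lia|]. destruct Rlt_dec; lia.
- intros j; unfold lab. rewrite px0. destruct Rlt_dec as [H|H]; auto.
  elim H. apply fL. apply Hpy.
- intros j; unfold lab. rewrite pxn. destruct Rlt_dec as [H|H].
  + assert (f x1 (py j) < 0) by (apply fR; apply Hpy). lra.
  + destruct Rlt_dec; lia.
- intros i; unfold lab. rewrite py0. destruct Rlt_dec; [lia|]. destruct Rlt_dec as [H|H]; [lia|].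
  elim H. apply gB. apply Hpx.
- intros i; unfold lab. rewrite pyn. destruct Rlt_dec; [lia|]. destruct Rlt_dec as [H|H]; [|lia].
  assert (g (px i) y1 < 0) by (apply gT; apply Hpx). lra.
- assert (Hpxi : px (S i) = px i + hx).
  { unfold px. rewrite !Nat.min_l by lia. rewrite S_INR. ring. }
  assert (Hpyj : py (S j) = py j + hy).
  { unfold py. rewrite !Nat.min_l by lia. rewrite S_INR. ring. }
  apply (Hd (px i) (py j) (Hpx i) (Hpy j)). intros [u [v [Hu [Hv [D1 [D2 D3]]]]]].
  destruct (Hdelta u v Hu Hv) as [_ HG].
  set (D := pos (delta u v)) in *.
  assert (Hclx : forall i', i' = i \/ i' = S i -> Rabs (px i' - u) < 2 * D).
  { intros i' [-> | ->].
    - assert (0 < D) by apply cond_pos. lra.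
    - rewrite Hpxi. apply Rabs_def2 in D1. apply Rabs_def1; lra. }
  assert (Hcly : forall i', i' = j \/ i' = S j -> Rabs (py i' - v) < 2 * D).
  { intros i' [-> | ->].
    - assert (0 < D) by apply cond_pos. lra.
    - rewrite Hpyj. apply Rabs_def2 in D2. apply Rabs_def1; lra. }
  assert (Hcorner : forall k, (k <= 2)%nat -> exists i' j', lab i' j' = k /\
     x0 <= px i' <= x1 /\ y0 <= py j' <= y1 /\ Rabs (px i' - u) < 2 * D /\ Rabs (py j' - v) < 2 * D).
  { intros k Hk2. destruct (Hk k Hk2) as [H|[H|[H|H]]];
    [exists i, j|exists (S i), j|exists i, (S j)|exists (S i), (S j)]; auto 10. }
  destruct (Hcorner 0%nat) as [i0 [j0 [L0 [A0 [B0 [U0 V0]]]]]]; [lia|].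
  destruct (Hcorner 1%nat) as [i1 [j1 [L1 [A1 [B1 [U1 V1]]]]]]; [lia|].
  destruct (Hcorner 2%nat) as [i2 [j2 [L2 [A2 [B2 [U2 V2]]]]]]; [lia|].
  unfold lab in L0, L1, L2.
  destruct (Rlt_dec 0 (f (px i0) (py j0))); [|destruct Rlt_dec; lia].
  destruct (Rlt_dec 0 (f (px i1) (py j1))); [lia|].
  destruct (Rlt_dec 0 (g (px i1) (py j1))); [|lia].
  destruct (Rlt_dec 0 (f (px i2) (py j2))); [lia|].
  destruct (Rlt_dec 0 (g (px i2) (py j2))); [lia|].
  destruct HG as [H|[H|[H|H]]].
  + specialize (H _ _ A1 B1 U1 V1). lra.
  + specialize (H _ _ A0 B0 U0 V0). lra.
  + specialize (H _ _ A2 B2 U2 V2). lra.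
  + specialize (H _ _ A1 B1 U1 V1). lra.
Qed.

(** * Integrals and continuity on the real line *)

(* Values of [RInt] carry a structure type in which [ring] finds no ring. *)
Ltac ringR := apply Rminus_diag_uniq; ring.
Ltac fieldR := apply Rminus_diag_uniq; field.

Lemma ex_RInt_cont (h : R -> R) (a b : R) :
  (forall x, continuous h x) -> ex_RInt h a b.
Proof. intros Hh. apply (ex_RInt_continuous (V := R_CompleteNormedModule)); auto. Qed.

Lemma RInt_congr (h k : R -> R) (a b : R) :
  (forall x, Rmin a b < x < Rmax a b -> h x = k x) -> RInt h a b = RInt k a b.
Proof. intros H. now apply (RInt_ext (V := R_CompleteNormedModule)). Qed.

Lemma RInt_sub (h k : R -> R) (a b : R) :
  ex_RInt h a b -> ex_RInt k a b ->
  RInt (fun x => h x - k x) a b = RInt h a b - RInt k a b.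
Proof. intros Hh Hk. apply (RInt_minus (V := R_CompleteNormedModule) h k a b Hh Hk). Qed.

Lemma RInt_mult_l (h : R -> R) (r a b : R) :
  ex_RInt h a b -> RInt (fun x => r * h x) a b = r * RInt h a b.
Proof. intros Hh. apply (RInt_scal (V := R_CompleteNormedModule) h a b r Hh). Qed.

Lemma RInt_split (h : R -> R) (a b c : R) :
  ex_RInt h a b -> ex_RInt h b c -> RInt h a b + RInt h b c = RInt h a c.
Proof. intros H1 H2. apply (RInt_Chasles (V := R_CompleteNormedModule) h a b c H1 H2). Qed.

Lemma RInt_affine (h : R -> R) (k d a b : R) :
  ex_RInt h (k * a + d) (k * b + d) -> k <> 0 ->
  RInt (fun x => h (k * x + d)) a b = / k * RInt h (k * a + d) (k * b + d).
Proof.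
intros Hh Hk.
rewrite <- (RInt_comp_lin (V := R_CompleteNormedModule) h k d a b Hh).
rewrite <- RInt_mult_l.
- apply RInt_congr. intros x _. unfold scal; simpl; unfold mult; simpl. field. exact Hk.
- now apply (ex_RInt_comp_lin (V := R_NormedModule)).
Qed.

Lemma is_derive_prim (h : R -> R) (c y : R) :
  (forall x, continuous h x) -> is_derive (fun z => RInt h c z) y (h y).
Proof.
intros Hh. apply (is_derive_RInt (V := R_NormedModule) h _ c y); auto.
apply filter_forall; intros z.
apply (RInt_correct (V := R_CompleteNormedModule)). now apply ex_RInt_cont.
Qed.

Lemma continuous_prim (h : R -> R) (c y : R) :
  (forall x, continuous h x) -> continuous (fun z => RInt h c z) y.
Proof.
intros Hh. apply (ex_derive_continuous (V := R_NormedModule)).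
exists (h y). now apply is_derive_prim.
Qed.

Lemma RInt_cst (r a b : R) : RInt (fun _ => r) a b = r * (b - a).
Proof.
rewrite (RInt_const (V := R_CompleteNormedModule)). unfold scal; simpl; unfold mult; simpl. ring.
Qed.

Lemma RInt_flip (h : R -> R) (a b : R) :
  (forall x, continuous h x) -> RInt (fun x => h (- x)) a b = RInt h (- b) (- a).
Proof.
intros Ch. rewrite (RInt_congr _ (fun x => h ((-1) * x + 0))).
- rewrite RInt_affine; [|now apply ex_RInt_cont|lra].
  replace (-1 * a + 0) with (- a) by ring. replace (-1 * b + 0) with (- b) by ring.
  rewrite <- (opp_RInt_swap (V := R_CompleteNormedModule)) by now apply ex_RInt_cont.
  unfold opp; simpl. fieldR.
- intros x _. f_equal. ring.
Qed.

Lemma RInt_translate (h : R -> R) (d a b : R) :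
  (forall x, continuous h x) -> RInt (fun x => h (d + x)) a b = RInt h (d + a) (d + b).
Proof.
intros Ch. rewrite (RInt_congr _ (fun x => h (1 * x + d))).
- rewrite RInt_affine; [|now apply ex_RInt_cont|lra].
  replace (1 * a + d) with (d + a) by ring. replace (1 * b + d) with (d + b) by ring.
  rewrite Rinv_1. ringR.
- intros x _. f_equal. ring.
Qed.

Lemma RInt_sub_cst (h : R -> R) (r a b : R) :
  (forall x, continuous h x) -> RInt (fun x => h x - r) a b = RInt h a b - r * (b - a).
Proof.
intros Ch. rewrite RInt_sub, RInt_cst; [reflexivity|now apply ex_RInt_cont|apply ex_RInt_const].
Qed.

Lemma RInt_cst_sub (h : R -> R) (r a b : R) :
  (forall x, continuous h x) -> RInt (fun x => r - h x) a b = r * (b - a) - RInt h a b.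
Proof.
intros Ch. rewrite RInt_sub, RInt_cst; [reflexivity|apply ex_RInt_const|now apply ex_RInt_cont].
Qed.

Lemma RInt_symmetric (h : R -> R) (T a b : R) :
  ex_RInt h a b -> (forall x, h (T - x) = h x) ->
  RInt h (T - b) (T - a) = RInt h a b.
Proof.
intros Hex Hs.
assert (E := RInt_affine h (-1) T (T - b) (T - a)).
replace (-1 * (T - b) + T) with b in E by ring.
replace (-1 * (T - a) + T) with a in E by ring.
rewrite <- (opp_RInt_swap (V := R_CompleteNormedModule) h a b Hex) in E.
rewrite (RInt_congr h (fun x => h (-1 * x + T)) (T - b) (T - a)).
- rewrite E; [unfold opp; simpl; fieldR|apply ex_RInt_swap, Hex|lra].
- intros x _. rewrite <- (Hs x). f_equal. ring.
Qed.

Lemma RInt_abs_bound (h : R -> R) (a b M : R) :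
  (forall x, continuous h x) -> (forall x, Rmin a b <= x <= Rmax a b -> Rabs (h x) <= M) ->
  Rabs (RInt h a b) <= Rabs (b - a) * M.
Proof.
intros Ch HM. destruct (Rle_or_lt a b) as [Hab|Hab].
- rewrite Rmin_left, Rmax_right in HM by lra. rewrite (Rabs_pos_eq (b - a)) by lra.
  apply abs_RInt_le_const; auto. now apply ex_RInt_cont.
- rewrite Rmin_right, Rmax_left in HM by lra. rewrite Rabs_minus_sym, (Rabs_pos_eq (a - b)) by lra.
  assert (E : RInt h a b = - RInt h b a).
  { symmetry. apply (opp_RInt_swap (V := R_CompleteNormedModule)). now apply ex_RInt_cont. }
  rewrite E, Rabs_Ropp. apply abs_RInt_le_const; [lra| |auto]. now apply ex_RInt_cont.
Qed.

Lemma is_derive_continuous (h : R -> R) (x l : R) : is_derive h x l -> continuous h x.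
Proof. intros H. apply (ex_derive_continuous (V := R_NormedModule)). now exists l. Qed.

Lemma is_derive_continuity_pt (h : R -> R) (x l : R) : is_derive h x l -> continuity_pt h x.
Proof. intros H. apply continuity_pt_filterlim. exact (is_derive_continuous h x l H). Qed.

Lemma continuous_eps (h : R -> R) (x : R) : continuous h x ->
  forall e, 0 < e -> exists d, 0 < d /\ forall y, Rabs (y - x) < d -> Rabs (h y - h x) < e.
Proof.
intros H e He. apply continuity_pt_filterlim in H. destruct (H e He) as [d [Hd H2]].
exists d; split; auto. intros y Hy.
destruct (Req_dec x y) as [<-|Hn]. { rewrite Rminus_diag, Rabs_R0; auto. }
apply (H2 y). split; [split; [exact I|auto]|exact Hy].
Qed.

Lemma nonincreasing_of_derive (h h' : R -> R) (a b : R) :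
  a <= b -> (forall x, a <= x <= b -> is_derive h x (h' x)) ->
  (forall x, a <= x <= b -> h' x <= 0) -> h b <= h a.
Proof.
intros Hab Hd Hn.
destruct (MVT_gen h a b h') as [x [Hx E]]; rewrite ?(Rmin_left a b), ?(Rmax_right a b) in * by lra.
- intros x Hx. apply Hd. lra.
- intros x Hx. apply (is_derive_continuity_pt h x (h' x)), Hd, Hx.
- assert (H := Hn x Hx). nra.
Qed.

Lemma mvt_open (h h' : R -> R) (a b : R) :
  a < b -> (forall x, a <= x <= b -> is_derive h x (h' x)) ->
  exists x, a < x < b /\ h b - h a = h' x * (b - a).
Proof.
intros Hab Hd. destruct (MVT_cor2 h h' a b Hab) as [x [E Hx]].
- intros x Hx. now apply is_derive_Reals, Hd.
- now exists x.
Qed.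

Lemma ivt_value (h : R -> R) (a b r : R) :
  (forall x, continuous h x) -> a <= b -> h a <= r <= h b ->
  exists x, a <= x <= b /\ h x = r.
Proof.
intros Ch Hab Hr.
destruct (IVT_gen h a b r) as [x [Hx E]].
- intros x. apply continuity_pt_filterlim, Ch.
- rewrite Rmin_left, Rmax_right; lra.
- rewrite Rmin_left, Rmax_right in Hx by lra. now exists x.
Qed.

(** * Autonomous second order equations with a Lipschitz right-hand side *)

(** Integration is bounded by [1 / A] in the norm with weight [exp (- A |y|)]. *)
Lemma RInt_exp_bound (h : R -> R) (A B y : R) :
  0 < A -> (forall x, continuous h x) ->
  (forall z, Rabs (h z) <= B * exp (A * Rabs z)) ->
  Rabs (RInt h 0 y) <= B / A * exp (A * Rabs y).
Proof.
intros HA Hc Hb.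
assert (HB : 0 <= B).
{ assert (H := Hb 0). rewrite Rabs_R0, Rmult_0_r, exp_0 in H.
  assert (0 <= Rabs (h 0)) by apply Rabs_pos. lra. }
assert (Hpos : forall k, (forall x, continuous k x) ->
   (forall z, Rabs (k z) <= B * exp (A * Rabs z)) ->
   forall x, 0 <= x -> Rabs (RInt k 0 x) <= B / A * exp (A * x)).
{ intros k Hk Hkb x Hx.
  assert (Hi : is_RInt (fun z => B * exp (A * z)) 0 x (B / A * exp (A * x) - B / A * exp (A * 0))).
  { apply (is_RInt_derive (V := R_CompleteNormedModule) (fun z => B / A * exp (A * z))).
    - intros z _. auto_derive; auto. field. lra.
    - intros z _. apply (ex_derive_continuous (V := R_NormedModule)). auto_derive. auto. }
  assert (H := norm_RInt_le (V := R_NormedModule) k (fun z => B * exp (A * z)) 0 x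
     (RInt k 0 x) (B / A * exp (A * x) - B / A * exp (A * 0)) Hx).
  assert (H2 : Rabs (RInt k 0 x) <= B / A * exp (A * x) - B / A * exp (A * 0)).
  { apply H; auto.
    - intros z Hz. assert (Hz2 := Hkb z). rewrite (Rabs_pos_eq z) in Hz2 by lra. exact Hz2.
    - apply (RInt_correct (V := R_CompleteNormedModule)). now apply ex_RInt_cont. }
  rewrite Rmult_0_r, exp_0 in H2.
  assert (0 <= B / A) by (apply Rdiv_le_0_compat; lra). lra. }
destruct (Rle_or_lt 0 y) as [Hy|Hy].
- rewrite (Rabs_pos_eq y) by lra. now apply Hpos.
- rewrite (Rabs_left y) by lra.
  assert (E : RInt h 0 y = - RInt (fun z => h (- z)) 0 (- y)).
  { rewrite (RInt_congr (fun z => h (- z)) (fun z => h ((-1) * z + 0))).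
    - rewrite RInt_affine; [|now apply ex_RInt_cont|lra].
      replace (-1 * 0 + 0) with 0 by ring. replace (-1 * - y + 0) with y by ring.
      fieldR.
    - intros x _. f_equal. ring. }
  rewrite E, Rabs_Ropp. apply Hpos; [| |lra].
  + intros x. apply continuous_comp; auto.
    apply (continuous_opp (V := R_NormedModule)), continuous_id.
  + intros z. rewrite <- (Rabs_Ropp z). apply Hb.
Qed.

Lemma exp_le_exp (x y : R) : x <= y -> exp x <= exp y.
Proof. intros [H | ->]; [apply Rlt_le, exp_increasing, H | apply Rle_refl]. Qed.

(** [u] solves [u'' = f(u)] on the whole line, and [u1 = u']. *)
Record trajectory (f u u1 : R -> R) : Prop := {
  traj_u : forall y, is_derive u y (u1 y);
  traj_u1 : forall y, is_derive u1 y (f (u y)) }.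
Arguments traj_u {f u u1} _ _.
Arguments traj_u1 {f u u1} _ _.

(** [f] is Lipschitz on the whole line with constant [L]. *)
Definition lipschitz (L : R) (f : R -> R) : Prop :=
  forall x y, Rabs (f x - f y) <= L * Rabs (x - y).

Lemma lipschitz_continuous (L : R) (f : R -> R) :
  lipschitz L f -> forall x, continuous f x.
Proof.
intros Hf x. apply continuity_pt_filterlim. intros e He.
assert (0 < Rabs L + 1) by (assert (0 <= Rabs L) by apply Rabs_pos; lra).
exists (e / (Rabs L + 1)). split. { apply Rdiv_lt_0_compat; lra. }
intros y [_ Hy]. simpl in Hy |- *. unfold R_dist in *.
apply Rle_lt_trans with ((Rabs L + 1) * Rabs (y - x)).
- apply Rle_trans with (1 := Hf y x). apply Rmult_le_compat_r; [apply Rabs_pos|].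
  assert (L <= Rabs L) by apply Rle_abs. lra.
- apply (Rmult_lt_compat_l (Rabs L + 1)) in Hy; auto.
  replace ((Rabs L + 1) * (e / (Rabs L + 1))) with e in Hy by (field; lra). exact Hy.
Qed.

(** The integral operator of the problem [u'' = f(u)], [u(0) = c], [u'(0) = v]. *)
Definition picard_step (f : R -> R) (c v : R) (w : R -> R) (y : R) : R :=
  c + RInt (fun z => v + RInt (fun x => f (w x)) 0 z) 0 y.

(** Picard iterates, starting from the constant [c]. *)
Fixpoint picard_iter (f : R -> R) (c v : R) (n : nat) : R -> R :=
  match n with
  | O => fun _ => c
  | S k => picard_step f c v (picard_iter f c v k)
  end.

Lemma picard_step_derive (f : R -> R) (c v : R) (w : R -> R) :
  (forall x, continuous f x) -> (forall x, continuous w x) ->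
  forall y, is_derive (picard_step f c v w) y (v + RInt (fun x => f (w x)) 0 y).
Proof.
intros Hf Hw y. unfold picard_step.
evar (l : R). replace (v + RInt (fun x => f (w x)) 0 y) with (plus 0 l).
- apply (is_derive_plus (V := R_NormedModule)).
  + apply (is_derive_const (V := R_NormedModule)).
  + unfold l. apply (is_derive_prim (fun z => v + RInt (fun x => f (w x)) 0 z)).
    intros x. apply (continuous_plus (V := R_NormedModule)).
    * apply continuous_const.
    * apply continuous_prim. intros z. apply continuous_comp; auto.
- unfold l, plus; simpl. ring.
Qed.

Lemma picard_step_continuous (f : R -> R) (c v : R) (w : R -> R) :
  (forall x, continuous f x) -> (forall x, continuous w x) ->
  forall y, continuous (picard_step f c v w) y.
Proof.
intros Hf Hw y. apply (ex_derive_continuous (V := R_NormedModule)).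
eexists. now apply picard_step_derive.
Qed.

(** Two integrations against the weight [exp (A |y|)] gain a factor [1 / A^2]. *)
Lemma picard_step_contract (L : R) (f : R -> R) (c v A D : R) (w w' : R -> R) :
  0 < A -> 0 <= L -> lipschitz L f ->
  (forall x, continuous w x) -> (forall x, continuous w' x) ->
  (forall y, Rabs (w y - w' y) <= D * exp (A * Rabs y)) ->
  forall y, Rabs (picard_step f c v w y - picard_step f c v w' y)
            <= L / A ^ 2 * D * exp (A * Rabs y).
Proof.
intros HA HL Hf Hw Hw' HD y.
assert (Cf := lipschitz_continuous L f Hf).
assert (C1 : forall x, continuous (fun x => f (w x)) x) by (intros x; apply continuous_comp; auto).
assert (C2 : forall x, continuous (fun x => f (w' x)) x) by (intros x; apply continuous_comp; auto).
assert (C3 : forall x, continuous (fun x => f (w x) - f (w' x)) x)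
  by (intros x; apply (continuous_minus (V := R_NormedModule)); auto).
assert (E1 : forall z, RInt (fun x => f (w x)) 0 z - RInt (fun x => f (w' x)) 0 z
                       = RInt (fun x => f (w x) - f (w' x)) 0 z).
{ intros z. symmetry.
  apply (RInt_minus (V := R_CompleteNormedModule) (fun x => f (w x)) (fun x => f (w' x)));
  now apply ex_RInt_cont. }
assert (D1 : forall z, continuous (fun z => v + RInt (fun x => f (w x)) 0 z) z).
{ intros z. apply (continuous_plus (V := R_NormedModule)); [apply continuous_const|].
  now apply continuous_prim. }
assert (D2 : forall z, continuous (fun z => v + RInt (fun x => f (w' x)) 0 z) z).
{ intros z. apply (continuous_plus (V := R_NormedModule)); [apply continuous_const|].
  now apply continuous_prim. }
replace (picard_step f c v w y - picard_step f c v w' y) with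
  (RInt (fun z => RInt (fun x => f (w x) - f (w' x)) 0 z) 0 y).
- replace (L / A ^ 2 * D) with (L * D / A / A) by (field; lra).
  apply RInt_exp_bound; auto.
  { intros x. now apply continuous_prim. }
  intros z. apply RInt_exp_bound; auto.
  intros x. apply Rle_trans with (1 := Hf _ _).
  rewrite Rmult_assoc. now apply Rmult_le_compat_l.
- unfold picard_step.
  rewrite (RInt_congr _ (fun z => (v + RInt (fun x => f (w x)) 0 z) - (v + RInt (fun x => f (w' x)) 0 z))).
  + rewrite RInt_sub; [ringR | |]; apply ex_RInt_cont; assumption.
  + intros z _. rewrite <- E1. ringR.
Qed.

Theorem trajectory_exists (L : R) (f : R -> R) (c v : R) :
  0 <= L -> lipschitz L f ->
  exists u u1, trajectory f u u1 /\ u 0 = c /\ u1 0 = v.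
Proof.
intros HL Hf.
assert (Cf := lipschitz_continuous L f Hf).
(* with this weight the Picard step halves distances *)
set (A := 2 * L + 1).
assert (HA : 1 <= A) by (unfold A; lra).
assert (HLA : L / A ^ 2 <= 1 / 2).
{ apply Rmult_le_reg_r with (A ^ 2); [nra|].
  replace (L / A ^ 2 * A ^ 2) with L by (field; lra). unfold A in *; nra. }
set (w := picard_iter f c v).
assert (Cw : forall n x, continuous (w n) x).
{ induction n as [|n IH]; intros x; simpl.
  - apply continuous_const.
  - now apply picard_step_continuous. }
set (M := (Rabs v + Rabs (f c) / A) / A).
assert (HM : 0 <= M).
{ assert (0 <= Rabs v) by apply Rabs_pos. assert (0 <= Rabs (f c)) by apply Rabs_pos.
  unfold M. apply Rdiv_le_0_compat; [|lra].
  assert (0 <= Rabs (f c) / A) by (apply Rdiv_le_0_compat; lra). lra. }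
assert (H1 : forall z, 1 <= exp (A * Rabs z)).
{ intros z. rewrite <- exp_0. assert (0 <= Rabs z) by apply Rabs_pos.
  apply exp_le_exp. nra. }
(* geometric decay of the increments, then of the distance to the limit *)
assert (Hstep : forall n y, Rabs (w (S n) y - w n y) <= M * (1 / 2) ^ n * exp (A * Rabs y)).
{ induction n as [|n IH]; intros y.
  - rewrite pow_O, Rmult_1_r.
    replace (w 1%nat y - w 0%nat y) with (RInt (fun z => v + RInt (fun _ => f c) 0 z) 0 y)
      by (unfold w; simpl; unfold picard_step; ringR).
    apply RInt_exp_bound; [lra| |].
    + intros x. apply (continuous_plus (V := R_NormedModule)); [apply continuous_const|].
      apply continuous_prim. intros; apply continuous_const.
    + intros z. apply Rle_trans with (1 := Rabs_triang _ _).
      rewrite Rmult_plus_distr_r. apply Rplus_le_compat.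
      * assert (0 <= Rabs v) by apply Rabs_pos. specialize (H1 z). nra.
      * apply RInt_exp_bound; [lra| |]. { intros; apply continuous_const. }
        intros x. assert (0 <= Rabs (f c)) by apply Rabs_pos. specialize (H1 x). nra.
  - apply Rle_trans with (L / A ^ 2 * (M * (1 / 2) ^ n) * exp (A * Rabs y)).
    + apply (picard_step_contract L f c v A _ (w (S n)) (w n)); auto. lra.
    + apply Rmult_le_compat_r; [apply Rlt_le, exp_pos|].
      replace (M * (1 / 2) ^ S n) with (1 / 2 * (M * (1 / 2) ^ n)) by (simpl; ring).
      apply Rmult_le_compat_r; auto. apply Rmult_le_pos; auto. apply pow_le; lra. }
assert (Hdist : forall k n y, Rabs (w (n + k)%nat y - w n y) <=
    2 * M * (1 / 2) ^ n * (1 - (1 / 2) ^ k) * exp (A * Rabs y)).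
{ induction k as [|k IH]; intros n y.
  - rewrite Nat.add_0_r. replace (w n y - w n y) with 0 by ring. rewrite Rabs_R0.
    simpl. lra.
  - replace (n + S k)%nat with (S (n + k)) by lia.
    replace (w (S (n + k)) y - w n y) with
      ((w (S (n + k)) y - w (n + k)%nat y) + (w (n + k)%nat y - w n y)) by ring.
    apply Rle_trans with (1 := Rabs_triang _ _).
    apply Rle_trans with (1 := Rplus_le_compat _ _ _ _ (Hstep _ _) (IH _ _)).
    rewrite pow_add. simpl. right. field. }
assert (Hdist2 : forall n k y, (n <= k)%nat -> Rabs (w k y - w n y) <= 2 * M * (1 / 2) ^ n * exp (A * Rabs y)).
{ intros n k y Hk. replace k with (n + (k - n))%nat by lia.
  apply Rle_trans with (1 := Hdist _ _ _).
  apply Rmult_le_compat_r; [apply Rlt_le, exp_pos|].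
  assert (0 <= (1 / 2) ^ (k - n)) by (apply pow_le; lra).
  assert (0 <= (1 / 2) ^ n) by (apply pow_le; lra).
  rewrite <- (Rmult_1_r (2 * M * (1 / 2) ^ n)) at 2.
  apply Rmult_le_compat_l; [|lra]. apply Rmult_le_pos; lra. }
assert (Hsmall : forall B e, 0 < e -> exists N, forall n, (N <= n)%nat -> 2 * M * (1 / 2) ^ n * B < e).
{ intros B e He.
  assert (Hl : is_lim_seq (fun n => (2 * M * B) * (1 / 2) ^ n) (2 * M * B * 0)).
  { apply (is_lim_seq_scal_l _ (2 * M * B) (Finite 0)). apply is_lim_seq_geom.
    rewrite Rabs_pos_eq; lra. }
  rewrite Rmult_0_r in Hl. apply is_lim_seq_spec in Hl.
  destruct (Hl (mkposreal e He)) as [N HN]. exists N. intros n Hn.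
  specialize (HN n Hn). simpl in HN. rewrite Rminus_0_r in HN.
  apply Rabs_def2 in HN. lra. }
assert (Hex : forall y, ex_finite_lim_seq (fun n => w n y)).
{ intros y. apply ex_lim_seq_cauchy_corr. intros e.
  destruct (Hsmall (2 * exp (A * Rabs y)) e (cond_pos e)) as [N HN].
  exists N. intros n k Hn Hk.
  replace (w n y - w k y) with ((w n y - w N y) + - (w k y - w N y)) by ring.
  apply Rle_lt_trans with (1 := Rabs_triang _ _). rewrite Rabs_Ropp.
  assert (A1 := Hdist2 N n y Hn). assert (A2 := Hdist2 N k y Hk).
  specialize (HN N (le_n N)). lra. }
set (u := fun y => real (Lim_seq (fun n => w n y))).
assert (Hu : forall y, is_lim_seq (fun n => w n y) (u y)).
{ intros y. apply Lim_seq_correct'. apply Hex. }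
assert (Hun : forall n y, Rabs (u y - w n y) <= 2 * M * (1 / 2) ^ n * exp (A * Rabs y)).
{ intros n y.
  apply (is_lim_seq_le_loc (fun k => Rabs (w k y - w n y)) (fun _ => 2 * M * (1 / 2) ^ n * exp (A * Rabs y))
    (Rabs (u y - w n y)) (2 * M * (1 / 2) ^ n * exp (A * Rabs y))).
  - exists n. intros k Hk. now apply Hdist2.
  - apply (is_lim_seq_abs _ (Finite (u y - w n y))).
    apply is_lim_seq_minus'; auto. apply is_lim_seq_const.
  - apply is_lim_seq_const. }
assert (Cu : forall y, continuous u y).
{ intros y. apply continuity_pt_filterlim. intros e He.
  destruct (Hsmall (exp (A * (Rabs y + 1))) (e / 3)) as [N HN]; [lra|].
  specialize (HN N (le_n N)).
  assert (Hcw : continuity_pt (w N) y) by (apply continuity_pt_filterlim; apply Cw).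
  destruct (Hcw (e / 3)) as [d [Hd Hd2]]; [lra|].
  exists (Rmin d 1). split. { apply Rmin_glb_lt; lra. }
  intros x [Dx Hx]. simpl in Hx |- *. unfold R_dist in *.
  assert (Hx1 : Rabs (x - y) < d) by (apply Rlt_le_trans with (1 := Hx), Rmin_l).
  assert (Hx2 : Rabs (x - y) < 1) by (apply Rlt_le_trans with (1 := Hx), Rmin_r).
  assert (Hb : forall z, Rabs z <= Rabs y + 1 -> Rabs (u z - w N z) < e / 3).
  { intros z Hz. apply Rle_lt_trans with (1 := Hun N z). apply Rle_lt_trans with (2 := HN).
    apply Rmult_le_compat_l.
    - apply Rmult_le_pos; [lra|]. apply pow_le; lra.
    - apply exp_le_exp. apply Rmult_le_compat_l; lra. }
  assert (B1 := Hb y ltac:(lra)).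
  assert (B2 : Rabs (u x - w N x) < e / 3).
  { apply Hb. replace x with (y + (x - y)) by ring.
    apply Rle_trans with (1 := Rabs_triang _ _). lra. }
  assert (B3 : Rabs (w N x - w N y) < e / 3).
  { apply (Hd2 x). split; auto. }
  apply Rabs_def2 in B1. apply Rabs_def2 in B2. apply Rabs_def2 in B3.
  apply Rabs_def1; lra. }
assert (Hfix : forall y, u y = picard_step f c v u y).
{ intros y. apply Rminus_diag_uniq.
  apply NNPP. intros Hne. apply Rabs_pos_lt in Hne.
  set (d := Rabs (u y - picard_step f c v u y)) in *.
  destruct (Hsmall (exp (A * Rabs y)) (d / 2)) as [N HN]; [lra|].
  assert (HN1 := HN (S N) ltac:(lia)). specialize (HN N (le_n N)).
  assert (B1 := Hun (S N) y).
  assert (B2 := picard_step_contract L f c v A (2 * M * (1 / 2) ^ N) u (w N)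
     ltac:(lra) HL Hf Cu (Cw N) (Hun N) y).
  assert (B3 : L / A ^ 2 * (2 * M * (1 / 2) ^ N) * exp (A * Rabs y) <= 1 * (2 * M * (1 / 2) ^ N * exp (A * Rabs y))).
  { rewrite Rmult_assoc. apply Rmult_le_compat_r; [|lra].
    apply Rmult_le_pos; [|apply Rlt_le, exp_pos]. apply Rmult_le_pos; [lra|]. apply pow_le; lra. }
  change (w (S N) y) with (picard_step f c v (w N) y) in B1.
  assert (B4 : d <= Rabs (u y - picard_step f c v (w N) y)
               + Rabs (picard_step f c v u y - picard_step f c v (w N) y)).
  { unfold d. replace (u y - picard_step f c v u y) with
      ((u y - picard_step f c v (w N) y) + - (picard_step f c v u y - picard_step f c v (w N) y)) by ring.
    apply Rle_trans with (1 := Rabs_triang _ _). rewrite Rabs_Ropp. lra. }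
  lra. }
assert (Cfu : forall x, continuous (fun x => f (u x)) x) by (intros; apply continuous_comp; auto).
exists u, (fun y => v + RInt (fun x => f (u x)) 0 y). split; [split|split].
- intros y. apply (is_derive_ext (picard_step f c v u)).
  + intros z. symmetry. apply Hfix.
  + now apply picard_step_derive.
- intros y.
  replace (f (u y)) with (plus 0 (f (u y))) by (unfold plus; simpl; ring).
  apply (is_derive_plus (V := R_NormedModule)).
  + apply (is_derive_const (V := R_NormedModule)).
  + now apply (is_derive_prim (fun x => f (u x))).
- rewrite Hfix. unfold picard_step. rewrite (RInt_point (V := R_CompleteNormedModule)).
  unfold zero; simpl; ring.
- rewrite (RInt_point (V := R_CompleteNormedModule)). unfold zero; simpl; ring.
Qed.

(** Time reversal about [T / 2]. *)
Lemma trajectory_reverse (f u u1 : R -> R) (T : R) :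
  trajectory f u u1 -> trajectory f (fun y => u (T - y)) (fun y => - u1 (T - y)).
Proof.
intros [Hu Hu1]; split; intros y.
- evar_last.
  + apply (is_derive_comp (K := R_AbsRing) (V := R_NormedModule) u (fun y => T - y)); [apply Hu|].
    auto_derive; auto.
  + unfold scal; simpl; unfold mult; simpl; ring.
- evar_last.
  + apply (is_derive_opp (fun y => u1 (T - y))).
    apply (is_derive_comp (K := R_AbsRing) (V := R_NormedModule) u1 (fun y => T - y)); [apply Hu1|].
    auto_derive; auto.
  + unfold scal, opp; simpl; unfold mult; simpl; ring.
Qed.

Lemma trajectory_shift (f u u1 : R -> R) (T : R) :
  trajectory f u u1 -> trajectory f (fun y => u (T + y)) (fun y => u1 (T + y)).
Proof.
intros [Hu Hu1]; split; intros y; evar_last.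
- apply (is_derive_comp (K := R_AbsRing) (V := R_NormedModule) u (fun y => T + y)); [apply Hu|].
  auto_derive; auto.
- unfold scal; simpl; unfold mult; simpl; ring.
- apply (is_derive_comp (K := R_AbsRing) (V := R_NormedModule) u1 (fun y => T + y)); [apply Hu1|].
  auto_derive; auto.
- unfold scal; simpl; unfold mult; simpl; ring.
Qed.

(** The point reflection [(y, r) |-> (-y, -r)] exchanges the two halves of a
    monotone transition. *)
Lemma trajectory_reflect (f u u1 : R -> R) :
  trajectory f u u1 ->
  trajectory (fun r => - f (- r)) (fun y => - u (- y)) (fun y => u1 (- y)).
Proof.
intros [Hu Hu1]; split; intros y; evar_last.
- apply (is_derive_opp (fun y => u (- y))).
  apply (is_derive_comp (K := R_AbsRing) (V := R_NormedModule) u (fun y => - y)); [apply Hu|].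
  auto_derive; auto.
- unfold scal, opp; simpl; unfold mult; simpl; ring.
- apply (is_derive_comp (K := R_AbsRing) (V := R_NormedModule) u1 (fun y => - y)); [apply Hu1|].
  auto_derive; auto.
- rewrite Ropp_involutive. unfold scal; simpl; unfold mult; simpl; ring.
Qed.

(** The quantity [(u - w)^2 + (u' - w')^2 + delta^2] grows at most at the
    exponential rate [L + 2]. *)
Lemma trajectory_gronwall (L delta : R) (f k u u1 w w1 : R -> R) :
  0 <= L -> lipschitz L f -> (forall r, Rabs (f r - k r) <= delta) ->
  trajectory f u u1 -> trajectory k w w1 ->
  forall y, (u y - w y) ^ 2 + (u1 y - w1 y) ^ 2 <=
    ((u 0 - w 0) ^ 2 + (u1 0 - w1 0) ^ 2 + delta ^ 2) * exp ((L + 2) * Rabs y).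
Proof.
intros HL Hf Hfk.
assert (Hpos : forall u u1 w w1 : R -> R, trajectory f u u1 -> trajectory k w w1 ->
  forall y, 0 <= y -> (u y - w y) ^ 2 + (u1 y - w1 y) ^ 2 <=
    ((u 0 - w 0) ^ 2 + (u1 0 - w1 0) ^ 2 + delta ^ 2) * exp ((L + 2) * y)).
{ clear u u1 w w1. intros u u1 w w1 [Hu Hu1] [Hw Hw1] y Hy.
  set (N := fun y => (u y - w y) ^ 2 + (u1 y - w1 y) ^ 2 + delta ^ 2).
  set (E := fun y => N y * exp (- (L + 2) * y)).
  set (N' := fun y => 2 * (u y - w y) * (u1 y - w1 y) + 2 * (u1 y - w1 y) * (f (u y) - k (w y))).
  assert (HE : E y <= E 0).
  { apply (nonincreasing_of_derive E (fun x => (N' x - (L + 2) * N x) * exp (- (L + 2) * x))); auto.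
    - intros x _. unfold E, N, N'.
      assert (A1 := Hu x). assert (A2 := Hu1 x). assert (A3 := Hw x). assert (A4 := Hw1 x).
      auto_derive.
      + repeat split; auto; eexists; eassumption.
      + rewrite (is_derive_unique (fun x0 : R => u x0) _ _ A1), (is_derive_unique (fun x0 : R => u1 x0) _ _ A2),
          (is_derive_unique (fun x0 : R => w x0) _ _ A3), (is_derive_unique (fun x0 : R => w1 x0) _ _ A4).
        ring.
    - intros x _. assert (0 < exp (- (L + 2) * x)) by apply exp_pos.
      assert (N' x - (L + 2) * N x <= 0); [|nra].
      unfold N', N. set (d := u x - w x). set (e := u1 x - w1 x).
      assert (Hb : Rabs (f (u x) - k (w x)) <= L * Rabs d + delta).
      { replace (f (u x) - k (w x)) with ((f (u x) - f (w x)) + (f (w x) - k (w x))) by ring.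
        apply Rle_trans with (1 := Rabs_triang _ _). apply Rplus_le_compat; auto. }
      assert (H1 : 2 * d * e <= d ^ 2 + e ^ 2) by (assert (0 <= (d - e) ^ 2) by apply pow2_ge_0; nra).
      assert (H2 : e * (f (u x) - k (w x)) <= Rabs e * (L * Rabs d + delta)).
      { apply Rle_trans with (1 := Rle_abs _). rewrite Rabs_mult.
        apply Rmult_le_compat_l; auto. apply Rabs_pos. }
      assert (H3 : 2 * (Rabs e * Rabs d) <= d ^ 2 + e ^ 2).
      { rewrite <- (pow2_abs d), <- (pow2_abs e).
        assert (0 <= (Rabs d - Rabs e) ^ 2) by apply pow2_ge_0. nra. }
      assert (H4 : 2 * (Rabs e * delta) <= e ^ 2 + delta ^ 2).
      { rewrite <- (pow2_abs e). assert (0 <= (Rabs e - delta) ^ 2) by apply pow2_ge_0. nra. }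
      assert (0 <= d ^ 2) by apply pow2_ge_0. assert (0 <= delta ^ 2) by apply pow2_ge_0.
      assert (HL5 : L * (2 * (Rabs e * Rabs d)) <= L * (d ^ 2 + e ^ 2)) by (apply Rmult_le_compat_l; auto).
      nra. }
  unfold E in HE. rewrite Rmult_0_r, exp_0, Rmult_1_r in HE.
  assert (Hx : exp (- (L + 2) * y) * exp ((L + 2) * y) = 1).
  { rewrite <- exp_plus. replace (- (L + 2) * y + (L + 2) * y) with 0 by ring. apply exp_0. }
  apply (Rmult_le_compat_r (exp ((L + 2) * y))) in HE; [|apply Rlt_le, exp_pos].
  rewrite Rmult_assoc, Hx, Rmult_1_r in HE. unfold N in HE at 1.
  assert (0 <= delta ^ 2) by apply pow2_ge_0. fold (N 0). lra. }
intros Hu Hw y. destruct (Rle_or_lt 0 y) as [Hy|Hy].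
- rewrite (Rabs_pos_eq y) by lra. now apply Hpos.
- rewrite (Rabs_left y) by lra.
  assert (H := Hpos _ _ _ _ (trajectory_reverse f u u1 0 Hu) (trajectory_reverse k w w1 0 Hw) (- y) ltac:(lra)).
  simpl in H. replace (0 - - y) with y in H by ring. replace (0 - 0) with 0 in H by ring.
  simpl. lra.
Qed.

Corollary trajectory_unique (L : R) (f u u1 w w1 : R -> R) :
  0 <= L -> lipschitz L f -> trajectory f u u1 -> trajectory f w w1 ->
  u 0 = w 0 -> u1 0 = w1 0 -> forall y, u y = w y /\ u1 y = w1 y.
Proof.
intros HL Hf Hu Hw E0 E1 y.
assert (H := trajectory_gronwall L 0 f f u u1 w w1 HL Hf
  ltac:(intros r; rewrite Rminus_diag, Rabs_R0; lra) Hu Hw y).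
rewrite E0, E1 in H.
replace ((w 0 - w 0) ^ 2 + (w1 0 - w1 0) ^ 2 + 0 ^ 2) with 0 in H by ring.
rewrite Rmult_0_l in H.
assert (0 <= (u y - w y) ^ 2) by apply pow2_ge_0.
assert (0 <= (u1 y - w1 y) ^ 2) by apply pow2_ge_0.
split; apply Rminus_diag_uniq; apply Rsqr_0_uniq; unfold Rsqr; nra.
Qed.

(** Continuous dependence on the constant force and on the initial velocity,
    uniformly on [[- K, K]]. *)
Lemma trajectory_close (L lam0 v0 K e : R) (g u u1 : R -> R) :
  0 <= L -> lipschitz L g -> 0 < e -> 
  trajectory (fun r => g r - lam0) u u1 -> u1 0 = v0 ->
  exists d, 0 < d /\ forall lam v w w1,
    Rabs (lam - lam0) < d -> Rabs (v - v0) < d ->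
    trajectory (fun r => g r - lam) w w1 -> w 0 = u 0 -> w1 0 = v ->
    forall y, Rabs y <= K -> Rabs (w y - u y) < e /\ Rabs (w1 y - u1 y) < e.
Proof.
intros HL Hg He Hu Ev0.
assert (HX : 0 < exp ((L + 2) * K)) by apply exp_pos.
set (d := e / (2 * (exp ((L + 2) * K) + 1))).
assert (Hd : 0 < d) by (apply Rdiv_lt_0_compat; lra).
exists d; split; auto. intros lam v w w1 Hl Hv Hw E0 E1 y Hy.
assert (Hg' : lipschitz L (fun r => g r - lam0)).
{ intros r s. replace (g r - lam0 - (g s - lam0)) with (g r - g s) by ring. apply Hg. }
assert (H := trajectory_gronwall L (Rabs (lam - lam0)) _ (fun r => g r - lam) _ _ _ _ HL Hg'
  ltac:(intros r; simpl; replace (g r - lam0 - (g r - lam)) with (lam - lam0) by ring; lra) Hu Hw y).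
rewrite E0, Ev0, E1, Rminus_diag, pow2_abs in H.
assert (H1 : exp ((L + 2) * Rabs y) <= exp ((L + 2) * K)).
{ apply exp_le_exp. apply Rmult_le_compat_l; lra. }
assert (H2 : (v0 - v) ^ 2 < d ^ 2).
{ rewrite <- (pow2_abs (v0 - v)), Rabs_minus_sym. assert (0 <= Rabs (v - v0)) by apply Rabs_pos. nra. }
assert (H3 : (lam - lam0) ^ 2 < d ^ 2).
{ rewrite <- (pow2_abs (lam - lam0)). assert (0 <= Rabs (lam - lam0)) by apply Rabs_pos. nra. }
assert (H4 : (u y - w y) ^ 2 + (u1 y - w1 y) ^ 2 < e ^ 2).
{ apply Rle_lt_trans with (1 := H).
  assert (He2 : e = 2 * (exp ((L + 2) * K) + 1) * d) by (unfold d; field; lra).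
  set (X := exp ((L + 2) * K)) in *. set (Z := exp ((L + 2) * Rabs y)) in *.
  assert (0 < Z) by apply exp_pos.
  assert (0 <= (v0 - v) ^ 2) by apply pow2_ge_0. assert (0 <= (lam - lam0) ^ 2) by apply pow2_ge_0.
  apply Rle_lt_trans with (2 * d ^ 2 * X).
  - apply Rle_trans with (2 * d ^ 2 * Z); [apply Rmult_le_compat_r; lra|].
    apply Rmult_le_compat_l; nra.
  - rewrite He2. assert (0 < d ^ 2) by nra. 
    replace ((2 * (X + 1) * d) ^ 2) with (4 * (X + 1) ^ 2 * d ^ 2) by ring.
    replace (2 * d ^ 2 * X) with (2 * X * d ^ 2) by ring.
    apply Rmult_lt_compat_r; auto. nra. }
assert (0 <= (u y - w y) ^ 2) by apply pow2_ge_0.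
assert (0 <= (u1 y - w1 y) ^ 2) by apply pow2_ge_0.
split; rewrite Rabs_minus_sym.
- rewrite <- (Rabs_pos_eq e) by lra. apply Rsqr_lt_abs_0. unfold Rsqr. nra.
- rewrite <- (Rabs_pos_eq e) by lra. apply Rsqr_lt_abs_0. unfold Rsqr. nra.
Qed.

(** * First turning time of a trajectory *)

(** [T] is the first zero of [z] on [[0, K]], or [K] if there is none before [K]. *)
Definition is_exit_time (z : R -> R) (K T : R) : Prop :=
  0 < T <= K /\ (forall x, 0 <= x < T -> 0 < z x) /\ (T < K -> z T = 0).

Lemma exit_time_exists (z : R -> R) (K : R) :
  (forall x, continuous z x) -> 0 < z 0 -> 0 < K -> exists T, is_exit_time z K T.
Proof.
intros Cz Hz HK.
set (E := fun y => 0 <= y <= K /\ forall x, 0 <= x <= y -> 0 < z x).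
destruct (completeness E) as [T [HT1 HT2]].
{ exists K. intros y [Hy _]. lra. }
{ exists 0. split; [lra|]. intros x Hx. replace x with 0 by lra. auto. }
assert (HTK : T <= K) by (apply HT2; intros y [Hy _]; lra).
assert (H0 : 0 <= T).
{ apply HT1. split; [lra|]. intros x Hx. replace x with 0 by lra. auto. }
assert (Hbelow : forall x, 0 <= x < T -> 0 < z x).
{ intros x Hx. apply NNPP; intros Hn. 
  assert (T <= x); [|lra]. apply HT2. intros y [Hy Hy2].
  destruct (Rle_or_lt y x); auto. elim Hn. apply Hy2. lra. }
(* positivity at [T < K] would extend beyond [T] *)
assert (Hext : 0 < z T -> T < K -> False).
{ intros Hp HTK'. destruct (continuous_eps z T (Cz T) (z T) Hp) as [d [Hd Hd2]].
  set (y := Rmin (T + d / 2) K).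
  assert (Hy : T < y) by (apply Rmin_glb_lt; lra).
  assert (Hy2 : y <= T + d / 2) by apply Rmin_l. assert (Hy3 : y <= K) by apply Rmin_r.
  assert (HE : E y).
  { split; [lra|]. intros x Hx. destruct (Rlt_or_le x T) as [H|H]; [apply Hbelow; lra|].
    assert (Hx2 := Hd2 x ltac:(rewrite Rabs_pos_eq; lra)). apply Rabs_def2 in Hx2. lra. }
  specialize (HT1 y HE). lra. }
assert (HT : 0 < T).
{ destruct (Req_dec T 0) as [E0|]; [|lra]. exfalso. apply Hext; rewrite E0; auto. }
exists T. split; [lra|]. split; auto. intros HTK'.
destruct (Rtotal_order (z T) 0) as [H|[H|H]]; auto; exfalso.
- destruct (continuous_eps z T (Cz T) (- z T) ltac:(lra)) as [d [Hd Hd2]].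
  set (y := Rmax (T - d / 2) 0).
  assert (Hy : y < T) by (apply Rmax_lub_lt; lra).
  assert (Hy2 : T - d / 2 <= y) by apply Rmax_l. assert (Hy3 : 0 <= y) by apply Rmax_r.
  assert (Hx2 := Hd2 y ltac:(rewrite Rabs_left; lra)). apply Rabs_def2 in Hx2.
  assert (0 < z y) by (apply Hbelow; lra). lra.
- now apply Hext.
Qed.

(** The exit time depends continuously on the function as soon as the function
    changes sign at an exit before [K]. *)
Lemma exit_time_stable (z0 : R -> R) (K T0 : R) :
  (forall x, continuous z0 x) -> is_exit_time z0 K T0 ->
  (T0 < K -> forall e, 0 < e -> exists y, T0 < y < T0 + e /\ z0 y < 0) ->
  forall e, 0 < e -> exists d, 0 < d /\ forall z T, is_exit_time z K T ->
    (forall y, 0 <= y <= K -> Rabs (z y - z0 y) < d) -> Rabs (T - T0) < e.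
Proof.
intros Cz [HT0 [Hp Hz]] Htr e He.
assert (Hlow : exists d, 0 < d /\ forall z T, is_exit_time z K T ->
    (forall y, 0 <= y <= K -> Rabs (z y - z0 y) < d) -> T0 - e < T).
{ destruct (Rle_or_lt (T0 - e / 2) 0) as [H|H].
  { exists 1. split; [lra|]. intros z T [HT _] _. lra. }
  destruct (continuity_ab_min z0 0 (T0 - e / 2)) as [x [Hx Hx2]]; [lra| |].
  { intros x _. apply continuity_pt_filterlim, Cz. }
  exists (z0 x). split. { apply Hp. lra. }
  intros z T [HT [_ HzT]] Hc. destruct (Rlt_or_le (T0 - e) T) as [|Hle]; auto. exfalso.
  rewrite <- (Rplus_0_r (z0 x)) in Hc.
  assert (H1 := Hc T ltac:(lra)). rewrite HzT in H1 by lra.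
  assert (H2 := Hx T ltac:(lra)). apply Rabs_def2 in H1. lra. }
assert (Hup : exists d, 0 < d /\ forall z T, is_exit_time z K T ->
    (forall y, 0 <= y <= K -> Rabs (z y - z0 y) < d) -> T < T0 + e).
{ destruct (Rlt_or_le T0 K) as [H|H].
  - destruct (Htr H (Rmin e (K - T0))) as [y [Hy Hy2]]. { apply Rmin_glb_lt; lra. }
    assert (Hm1 : Rmin e (K - T0) <= e) by apply Rmin_l.
    assert (Hm2 : Rmin e (K - T0) <= K - T0) by apply Rmin_r.
    exists (- z0 y). split; [lra|]. intros z T [HT [HzT _]] Hc.
    destruct (Rlt_or_le T (T0 + e)) as [|Hle]; auto. exfalso.
    assert (H1 := Hc y ltac:(lra)). assert (H2 := HzT y ltac:(lra)). apply Rabs_def2 in H1. lra.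
  - exists 1. split; [lra|]. intros z T [HT _] _. lra. }
destruct Hlow as [d1 [Hd1 H1]]. destruct Hup as [d2 [Hd2 H2]].
exists (Rmin d1 d2). split; [now apply Rmin_glb_lt|]. intros z T HT Hc.
apply Rabs_def1.
- assert (H := H2 z T HT ltac:(intros y Hy; apply Rlt_le_trans with (1 := Hc y Hy), Rmin_r)). lra.
- assert (H := H1 z T HT ltac:(intros y Hy; apply Rlt_le_trans with (1 := Hc y Hy), Rmin_l)). lra.
Qed.

(** * Half of a transition *)

(** The trajectory [u] leaves [c] to the right, with energy identity
    [u'^2 = 2 V(u)], and [V] stays above the barrier [kap / 2 * (q - r)] on
    [[c, q]], so that [u] reaches [q] within a time depending only on the
    barrier. *)
Record half_transition (L : R) (f V : R -> R) (kap c q : R) (u u1 : R -> R) : Prop := {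
  ht_L : 0 <= L;
  ht_lip : lipschitz L f;
  ht_traj : trajectory f u u1;
  ht_c : u 0 = c;
  ht_v : 0 < u1 0;
  ht_energy : forall y, u1 y ^ 2 = 2 * V (u y);
  ht_cq : c < q;
  ht_kap : 0 < kap;
  ht_barrier : forall r, c <= r <= q -> kap / 2 * (q - r) <= V r }.

Arguments ht_L {L f V kap c q u u1} _.
Arguments ht_lip {L f V kap c q u u1} _ _ _.
Arguments ht_traj {L f V kap c q u u1} _.
Arguments ht_c {L f V kap c q u u1} _.
Arguments ht_v {L f V kap c q u u1} _.
Arguments ht_energy {L f V kap c q u u1} _ _.
Arguments ht_cq {L f V kap c q u u1} _.
Arguments ht_kap {L f V kap c q u u1} _.
Arguments ht_barrier {L f V kap c q u u1} _ _ _.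

(** Time needed to reach [q] from [c] along the barrier: the solution of
    [u'^2 = kap * (q - u)] has [sqrt (q - u)] decreasing at rate
    [sqrt kap / 2]. *)
Definition barrier_time (kap c q : R) : R := 2 * sqrt ((q - c) / kap).

Lemma ht_continuous {L : R} {f V : R -> R} {kap c q : R} {u u1 : R -> R} :
  half_transition L f V kap c q u u1 ->
  (forall y, continuous u y) /\ (forall y, continuous u1 y).
Proof.
intros H. destruct (ht_traj H) as [Hu Hu1].
split; intros y; eapply is_derive_continuous; [apply Hu | apply Hu1].
Qed.

Lemma trajectory_increasing {f u u1 : R -> R} {K T : R} (x y : R) :
  trajectory f u u1 -> is_exit_time u1 K T -> 0 <= x < y -> y <= T -> u x < u y.
Proof.
intros [Hu Hu1] [HT [Hp _]] Hx Hy.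
destruct (mvt_open u u1 x y) as [z [Hz E]]; [lra|auto|].
assert (0 < u1 z) by (apply Hp; lra). nra.
Qed.

Lemma ht_range {L : R} {f V : R -> R} {kap c q : R} {u u1 : R -> R} {K T : R} (y : R) :
  half_transition L f V kap c q u u1 -> is_exit_time u1 K T -> 0 <= y <= T -> c <= u y.
Proof.
intros H HT Hy. rewrite <- (ht_c H).
destruct (Req_dec y 0) as [->|]; [apply Rle_refl|].
apply Rlt_le. apply (trajectory_increasing _ _ (ht_traj H) HT); lra.
Qed.

(** A turning point before [K] is no equilibrium, hence the velocity really
    changes sign there. *)
Lemma ht_turn {L : R} {f V : R -> R} {kap c q : R} {u u1 : R -> R} {K T : R} :
  half_transition L f V kap c q u u1 -> is_exit_time u1 K T ->
  T < K -> forall e, 0 < e -> exists y, T < y < T + e /\ u1 y < 0.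
Proof.
intros H [HT [Hp Hz]] HTK e He.
assert (Hz0 := Hz HTK).
destruct (ht_continuous H) as [Cu Cu1].
destruct (ht_traj H) as [Hu Hu1].
assert (Cf := lipschitz_continuous L f (ht_lip H)).
assert (Cfu : forall y, continuous (fun y => f (u y)) y) by (intros; apply continuous_comp; auto).
destruct (Rtotal_order (f (u T)) 0) as [Hf|[Hf|Hf]].
- destruct (continuous_eps _ T (Cfu T) (- f (u T)) ltac:(lra)) as [d [Hd Hd2]].
  set (y := T + Rmin e d / 2).
  assert (Hm : 0 < Rmin e d) by (apply Rmin_glb_lt; lra).
  assert (Hm1 : Rmin e d <= e) by apply Rmin_l. assert (Hm2 : Rmin e d <= d) by apply Rmin_r.
  exists y. split; [unfold y; lra|].
  destruct (mvt_open u1 (fun x => f (u x)) T y) as [x [Hx E]]; [unfold y; lra|auto|].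
  assert (Hfx := Hd2 x ltac:(rewrite Rabs_pos_eq; unfold y in *; lra)). simpl in Hfx.
  apply Rabs_def2 in Hfx. assert (0 < y - T) by (unfold y; lra). nra.
- (* an equilibrium cannot be reached in finite time *)
  exfalso.
  assert (Hconst : trajectory f (fun _ => u T) (fun _ => 0)).
  { split; intros y; [|rewrite Hf]; apply (is_derive_const (V := R_NormedModule)). }
  assert (HU := trajectory_unique L f (fun y => u (T + y)) (fun y => u1 (T + y)) _ _
    (ht_L H) (ht_lip H)
    (trajectory_shift f u u1 T (ht_traj H)) Hconst
    ltac:(simpl; now rewrite Rplus_0_r) ltac:(simpl; now rewrite Rplus_0_r) (- T)).
  destruct HU as [_ HU]. simpl in HU. replace (T + - T) with 0 in HU by ring.
  assert (Hv := ht_v H). lra.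
- exfalso.
  destruct (continuous_eps _ T (Cfu T) (f (u T)) Hf) as [d [Hd Hd2]].
  set (y := Rmax 0 (T - d / 2)).
  assert (Hy : y < T) by (apply Rmax_lub_lt; lra).
  assert (Hy1 : 0 <= y) by apply Rmax_l. assert (Hy2 : T - d / 2 <= y) by apply Rmax_r.
  destruct (mvt_open u1 (fun x => f (u x)) y T) as [x [Hx E]]; [lra|auto|].
  assert (Hfx := Hd2 x ltac:(rewrite Rabs_left; lra)). simpl in Hfx.
  apply Rabs_def2 in Hfx. assert (0 < u1 y) by (apply Hp; lra). nra.
Qed.

(** Along the barrier [sqrt (q - u)] decreases at least at the rate
    [sqrt kap / 2]. *)
Lemma ht_fast {L : R} {f V : R -> R} {kap c q : R} {u u1 : R -> R} {K T : R} (y : R) :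
  half_transition L f V kap c q u u1 -> is_exit_time u1 K T ->
  barrier_time kap c q < y -> y < T -> q <= u y.
Proof.
intros H HT Hy HyT. destruct (Rle_or_lt q (u y)) as [|Hq]; auto. exfalso.
assert (Hcq := ht_cq H). assert (Hk := ht_kap H).
assert (Hc := ht_c H).
destruct (ht_traj H) as [Hu Hu1].
assert (Hb0 : 0 <= barrier_time kap c q).
{ unfold barrier_time. assert (0 <= sqrt ((q - c) / kap)) by apply sqrt_pos. lra. }
assert (Hux : forall x, 0 <= x <= y -> c <= u x <= u y).
{ intros x Hx. split.
  - apply (ht_range _ H HT). lra.
  - destruct (Req_dec x y) as [->|]; [apply Rle_refl|]. apply Rlt_le.
    apply (trajectory_increasing _ _ (ht_traj H) HT); lra. }
destruct (mvt_open (fun x => sqrt (q - u x)) (fun x => - u1 x / (2 * sqrt (q - u x))) 0 y) as [x [Hx E]].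
- lra.
- intros x Hx. assert (Hx2 := Hux x Hx). evar_last.
  + apply (is_derive_comp (K := R_AbsRing) (V := R_NormedModule) sqrt (fun x => q - u x)).
    * apply is_derive_Reals, derivable_pt_lim_sqrt. lra.
    * apply (is_derive_minus (V := R_NormedModule) (fun _ => q) u); [|apply Hu].
      apply (is_derive_const (V := R_NormedModule)).
  + unfold scal, minus, plus, opp, zero; simpl; unfold mult; simpl. field.
    apply Rgt_not_eq, sqrt_lt_R0. lra.
- rewrite Hc in E. assert (Hx2 := Hux x ltac:(lra)).
  assert (Hs : 0 < sqrt (q - u x)) by (apply sqrt_lt_R0; lra).
  assert (Hv : sqrt kap * sqrt (q - u x) <= u1 x).
  { apply Rsqr_incr_0_var.
    - rewrite <- sqrt_mult by lra. rewrite Rsqr_sqrt by (apply Rmult_le_pos; lra).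
      assert (He := ht_energy H x).
      assert (Hb := ht_barrier H (u x) ltac:(lra)).
      unfold Rsqr. nra.
    - apply Rlt_le. apply (proj1 (proj2 HT)). lra. }
  assert (Hrate : - u1 x / (2 * sqrt (q - u x)) <= - sqrt kap / 2).
  { apply Rmult_le_reg_r with (2 * sqrt (q - u x)); [lra|].
    replace (- u1 x / (2 * sqrt (q - u x)) * (2 * sqrt (q - u x))) with (- u1 x) by (field; lra).
    lra. }
  assert (Hsk : 0 < sqrt kap) by now apply sqrt_lt_R0.
  assert (Hqy : 0 <= sqrt (q - u y)) by apply sqrt_pos.
  unfold barrier_time in Hy. rewrite sqrt_div_alt in Hy by auto.
  assert (Hy2 : 2 * sqrt (q - c) < y * sqrt kap).
  { apply (Rmult_lt_compat_r (sqrt kap)) in Hy; auto.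
    replace (2 * (sqrt (q - c) / sqrt kap) * sqrt kap) with (2 * sqrt (q - c)) in Hy by (field; lra).
    lra. }
  nra.
Qed.

(** If [V] vanishes at [q], the trajectory cannot cross [q] before turning. *)
Lemma ht_exit_early {L : R} {f V : R -> R} {kap c q : R} {u u1 : R -> R} {K T : R} :
  half_transition L f V kap c q u u1 -> is_exit_time u1 K T -> V q = 0 ->
  T <= barrier_time kap c q.
Proof.
intros H HT HV. destruct (Rle_or_lt T (barrier_time kap c q)) as [|Hlt]; auto. exfalso.
assert (Hb0 : 0 <= barrier_time kap c q).
{ unfold barrier_time. assert (0 <= sqrt ((q - c) / kap)) by apply sqrt_pos. lra. }
set (y := (barrier_time kap c q + T) / 2).
assert (Hq : q <= u y) by (apply (ht_fast y H HT); unfold y; lra).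
assert (Hcq := ht_cq H).
destruct (ivt_value u 0 y q) as [x [Hx E]].
- apply (ht_continuous H).
- unfold y; lra.
- rewrite (ht_c H). lra.
- assert (He := ht_energy H x). rewrite E, HV in He.
  assert (0 < u1 x) by (apply (proj1 (proj2 HT)); unfold y in *; lra). nra.
Qed.

Lemma ht_no_exit {L : R} {f V : R -> R} {kap c q : R} {u u1 : R -> R} {K T : R} :
  half_transition L f V kap c q u u1 -> is_exit_time u1 K T ->
  (forall r, q <= r -> 0 < V r) -> T = K.
Proof.
intros H HT HV. destruct (Rlt_or_le T K) as [HTK|HTK]; [|destruct HT; lra]. exfalso.
assert (Hr : c <= u T) by (apply (ht_range _ H HT); destruct HT; lra).
assert (He := ht_energy H T).
destruct HT as [HT [_ Hz]]. rewrite (Hz HTK) in He.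
assert (Hk := ht_kap H).
destruct (Rlt_or_le (u T) q) as [Hq|Hq].
- assert (Hb := ht_barrier H (u T) ltac:(lra)). nra.
- specialize (HV _ Hq). nra.
Qed.

(** A weight that is at most [eta] beyond [q] has a small time integral. *)
Lemma ht_weight_bound {L : R} {f V : R -> R} {kap c q : R} {u u1 : R -> R} {K T : R} (eta : R)
  (psi : R -> R) :
  half_transition L f V kap c q u u1 -> is_exit_time u1 K T ->
  (forall r, continuous psi r) -> (forall r, 0 <= psi r <= 1) ->
  0 <= eta -> (forall r, q <= r -> psi r <= eta) ->
  0 <= RInt (fun y => psi (u y)) 0 T <= barrier_time kap c q + eta * K.
Proof.
intros H HT Cp Hp Heta Hq.
destruct (ht_continuous H) as [Cu _].
assert (Cpu : forall y, continuous (fun y => psi (u y)) y) by (intros; apply continuous_comp; auto).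
assert (HT' := proj1 HT).
set (C := barrier_time kap c q).
assert (HC : 0 <= C).
{ unfold C, barrier_time. assert (0 <= sqrt ((q - c) / kap)) by apply sqrt_pos. lra. }
split.
- apply RInt_ge_0; [lra|now apply ex_RInt_cont|]. intros x _. apply Hp.
- set (m := Rmin C T).
  assert (Hm1 : m <= C) by apply Rmin_l. assert (Hm2 : m <= T) by apply Rmin_r.
  assert (Hm0 : 0 <= m) by (apply Rmin_glb; lra).
  rewrite <- (RInt_split _ 0 m T) by now apply ex_RInt_cont.
  assert (I1 : RInt (fun y => psi (u y)) 0 m <= m).
  { apply Rle_trans with (RInt (fun _ => 1) 0 m).
    - apply RInt_le; auto; [now apply ex_RInt_cont|apply ex_RInt_const|]. intros x _. apply Hp.
    - rewrite (RInt_const (V := R_CompleteNormedModule)). unfold scal; simpl; unfold mult; simpl. lra. }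
  assert (I2 : RInt (fun y => psi (u y)) m T <= (T - m) * eta).
  { apply Rle_trans with (RInt (fun _ => eta) m T).
    - apply RInt_le; auto; [now apply ex_RInt_cont|apply ex_RInt_const|]. intros x Hx. apply Hq.
      apply (ht_fast _ H HT); [|lra].
      fold C. unfold m in Hx. destruct (Rle_or_lt C T) as [Hct|Hct].
      + rewrite Rmin_left in Hx; lra.
      + rewrite Rmin_right in Hx; lra.
    - rewrite (RInt_const (V := R_CompleteNormedModule)). unfold scal; simpl; unfold mult; simpl. lra. }
  assert (Hm3 : (T - m) * eta <= eta * K) by nra.
  apply Rle_trans with (m + (T - m) * eta); [now apply Rplus_le_compat|]. lra.
Qed.

Lemma ht_stable {L : R} {f V : R -> R} {kap c q : R} {u u1 : R -> R} {K T : R} (M : R)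
  (psi : R -> R) :
  half_transition L f V kap c q u u1 -> is_exit_time u1 K T ->
  0 <= M -> lipschitz M psi -> (forall r, 0 <= psi r <= 1) ->
  forall e, 0 < e -> exists d, 0 < d /\ forall w w1 T',
    (forall x, continuous w x) -> is_exit_time w1 K T' ->
    (forall y, 0 <= y <= K -> Rabs (w y - u y) < d /\ Rabs (w1 y - u1 y) < d) ->
    Rabs (T' - T) < e /\
    Rabs (RInt (fun y => psi (w y)) 0 T' - RInt (fun y => psi (u y)) 0 T) < e.
Proof.
intros H HT HM Hl Hp e He.
destruct (ht_continuous H) as [Cu Cu1].
assert (Cp := lipschitz_continuous M psi Hl).
assert (Cpu : forall y, continuous (fun y => psi (u y)) y) by (intros; apply continuous_comp; auto).
assert (HK : 0 < K) by (destruct HT; lra).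
destruct (exit_time_stable u1 K T Cu1 HT (ht_turn H HT) (e / 2)) as [d1 [Hd1 Hd]]; [lra|].
set (d2 := e / (2 * (K * M + 1))).
assert (HKM : 0 <= K * M) by (apply Rmult_le_pos; lra).
assert (Hd2 : 0 < d2) by (apply Rdiv_lt_0_compat; lra).
assert (Hd2' : K * (M * d2) < e / 2).
{ replace (e / 2) with ((K * M + 1) * d2) by (unfold d2; field; lra). nra. }
exists (Rmin d1 d2). split; [now apply Rmin_glb_lt|].
intros w w1 T' Cw HT' Hc.
assert (Cpw : forall y, continuous (fun y => psi (w y)) y) by (intros; apply continuous_comp; auto).
assert (A1 : Rabs (T' - T) < e / 2).
{ apply (Hd w1); auto. intros y Hy. apply Rlt_le_trans with (1 := proj2 (Hc y Hy)), Rmin_l. }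
split; [lra|].
assert (HT'K : 0 < T' <= K) by apply HT'.
replace (RInt (fun y => psi (w y)) 0 T' - RInt (fun y => psi (u y)) 0 T) with
  (RInt (fun y => psi (w y) - psi (u y)) 0 T' + RInt (fun y => psi (u y)) T T').
- apply Rle_lt_trans with (1 := Rabs_triang _ _).
  assert (A2 : Rabs (RInt (fun y => psi (w y) - psi (u y)) 0 T') <= Rabs (T' - 0) * (M * d2)).
  { apply RInt_abs_bound.
    - intros x. now apply (continuous_minus (V := R_NormedModule)).
    - intros x Hx. rewrite Rmin_left, Rmax_right in Hx by lra.
      apply Rle_trans with (1 := Hl _ _). apply Rmult_le_compat_l; auto. apply Rlt_le.
      apply Rlt_le_trans with (1 := proj1 (Hc x ltac:(lra))), Rmin_r. }
  assert (A3 : Rabs (RInt (fun y => psi (u y)) T T') <= Rabs (T' - T) * 1).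
  { apply RInt_abs_bound; auto. intros x _. rewrite Rabs_pos_eq; apply Hp. }
  rewrite (Rabs_pos_eq (T' - 0)) in A2 by lra.
  assert (A4 : (T' - 0) * (M * d2) <= K * (M * d2)).
  { apply Rmult_le_compat_r; [|lra]. apply Rmult_le_pos; lra. }
  lra.
- rewrite RInt_sub by now apply ex_RInt_cont.
  rewrite <- (RInt_split (fun y => psi (u y)) 0 T T') by now apply ex_RInt_cont. ringR.
Qed.

(** * Double-well potentials and shooting lines *)

(** [F] vanishes outside [(a, b)] and is positive inside; [g = F'] is
    Lipschitz. *)
Record double_well (L : R) (F g : R -> R) (a b : R) : Prop := {
  dw_lt : a < b;
  dw_L : 0 <= L;
  dw_lip : lipschitz L g;
  dw_derive : forall r, is_derive F r (g r);
  dw_left : forall r, r <= a -> F r = 0;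
  dw_right : forall r, b <= r -> F r = 0;
  dw_pos : forall r, a < r < b -> 0 < F r }.
Arguments dw_lt {L F g a b} _.
Arguments dw_L {L F g a b} _.
Arguments dw_lip {L F g a b} _ _ _.
Arguments dw_derive {L F g a b} _ _.
Arguments dw_left {L F g a b} _ _ _.
Arguments dw_right {L F g a b} _ _ _.
Arguments dw_pos {L F g a b} _ _ _.

Lemma double_well_reflect {L : R} {F g : R -> R} {a b : R} :
  double_well L F g a b ->
  double_well L (fun r => F (- r)) (fun r => - g (- r)) (- b) (- a).
Proof.
intros H. split.
- assert (h := dw_lt H). lra.
- apply H.
- intros x y. replace (- g (- x) - - g (- y)) with (g (- y) - g (- x)) by ring.
  apply Rle_trans with (1 := dw_lip H (- y) (- x)). right. do 2 f_equal. ring.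
- intros r. evar_last.
  + apply (is_derive_comp (K := R_AbsRing) (V := R_NormedModule) F (fun r => - r)); [apply (dw_derive H)|].
    auto_derive; auto.
  + unfold scal; simpl; unfold mult; simpl; ring.
- intros r Hr. apply (dw_right H). lra.
- intros r Hr. apply (dw_left H). lra.
- intros r Hr. apply (dw_pos H). lra.
Qed.

Lemma double_well_nonneg {L : R} {F g : R -> R} {a b : R} (r : R) :
  double_well L F g a b -> 0 <= F r.
Proof.
intros H. destruct (Rle_or_lt r a) as [|H1]. { rewrite (dw_left H); lra. }
destruct (Rle_or_lt b r) as [|H2]. { rewrite (dw_right H); lra. }
apply Rlt_le, (dw_pos H). lra.
Qed.

(** For small [kap], the minimum point [p] of [F r - kap * r] on [[a, c]] lies
    near [a], and [F] grows from [p] to [c] at least at the rate [kap]. *)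
Lemma barrier_point (L : R) (F g : R -> R) (a b c eta : R) :
  double_well L F g a b -> a < c < b -> 0 < eta ->
  exists kap0, 0 < kap0 /\ forall kap, 0 < kap <= kap0 ->
    exists p, a <= p < c /\ p <= a + eta /\ F p <= kap * (p - a) /\
      forall r, p <= r <= c -> kap * (r - p) <= F r - F p.
Proof.
intros H Hc Heta.
set (h := Rmin eta ((c - a) / 2)).
assert (Hh1 : h <= eta) by apply Rmin_l. assert (Hh2 : h <= (c - a) / 2) by apply Rmin_r.
assert (Hh : 0 < h) by (apply Rmin_glb_lt; lra).
assert (CF : forall x, continuity_pt F x).
{ intros x. apply (is_derive_continuity_pt _ _ _ (dw_derive H x)). }
destruct (continuity_ab_min F (a + h) c) as [x [Hx Hx2]]; [lra|auto|].
assert (Hmu : 0 < F x) by (apply (dw_pos H); lra).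
exists (F x / (2 * (c - a))). split. { apply Rdiv_lt_0_compat; lra. }
intros kap [Hk Hk2].
assert (Hk3 : kap * (c - a) <= F x / 2).
{ apply (Rmult_le_compat_r (c - a)) in Hk2; [|lra].
  replace (F x / (2 * (c - a)) * (c - a)) with (F x / 2) in Hk2 by (field; lra). lra. }
destruct (continuity_ab_min (fun r => F r - kap * r) a c) as [p [Hp Hp2]]; [lra| |].
{ intros r _. apply (is_derive_continuity_pt _ r (g r - kap)). evar_last.
  - apply (is_derive_minus (V := R_NormedModule) F (fun r => kap * r)); [apply (dw_derive H)|].
    auto_derive; [auto|reflexivity].
  - unfold minus, plus, opp; simpl. ring. }
assert (Hpa := Hp a ltac:(lra)). rewrite (dw_left H a) in Hpa by lra.
assert (Hpe : p < a + h).
{ destruct (Rlt_or_le p (a + h)) as [|Hge]; auto. exfalso.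
  assert (Hxp := Hx p ltac:(lra)). nra. }
exists p. repeat split; try lra.
intros r Hr. assert (Hpr := Hp r ltac:(lra)). lra.
Qed.

(** Slope and ordinate at [r] of the line through [(p, s)] and [(q, t)]. *)
Definition slope (p q s t : R) : R := (t - s) / (q - p).

Definition line (p q s t r : R) : R := s + slope p q s t * (r - p).

Lemma line_at_left (p q s t : R) : line p q s t p = s.
Proof. unfold line. ring. Qed.

Lemma line_from_right (p q s t r : R) :
  p < q -> line p q s t r = t + slope p q s t * (r - q).
Proof. intros H. unfold line, slope. field. lra. Qed.

(** A choice of base points [p < c < q] at which to shoot: [p] is within
    [eta * (b - a)] of [a], and [q] of [b]; from [p] and from [q], [F] grows
    towards [c] at least at the rate [kap]; and lines with heights in
    [[- del, F p]] at [p] and in [[- del, F q]] at [q] have slope at most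
    [kap / 2], so that they stay below [F] on [(p, q)]. *)
Record frame (L : R) (F g : R -> R) (a b eta kap del p c q : R) : Prop := {
  fr_dw : double_well L F g a b;
  fr_kap : 0 < kap;
  fr_del : 0 < del;
  fr_ap : a <= p;
  fr_pc : p < c;
  fr_cq : c < q;
  fr_qb : q <= b;
  fr_p : p <= a + eta * (b - a);
  fr_q : b - eta * (b - a) <= q;
  fr_left : forall r, p <= r <= c -> kap * (r - p) <= F r - F p;
  fr_right : forall r, c <= r <= q -> kap * (q - r) <= F r - F q;
  fr_slope : forall s t, - del <= s <= F p -> - del <= t <= F q ->
     Rabs (slope p q s t) <= kap / 2 }.
Arguments fr_dw {L F g a b eta kap del p c q} _.
Arguments fr_kap {L F g a b eta kap del p c q} _.
Arguments fr_del {L F g a b eta kap del p c q} _.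
Arguments fr_ap {L F g a b eta kap del p c q} _.
Arguments fr_pc {L F g a b eta kap del p c q} _.
Arguments fr_cq {L F g a b eta kap del p c q} _.
Arguments fr_qb {L F g a b eta kap del p c q} _.
Arguments fr_p {L F g a b eta kap del p c q} _.
Arguments fr_q {L F g a b eta kap del p c q} _.
Arguments fr_left {L F g a b eta kap del p c q} _ _ _.
Arguments fr_right {L F g a b eta kap del p c q} _ _ _.
Arguments fr_slope {L F g a b eta kap del p c q} _ _ _ _ _.

Lemma frame_exists (L : R) (F g : R -> R) (a b eta : R) :
  double_well L F g a b -> 0 < eta <= 1 / 16 ->
  exists kap del p c q, frame L F g a b eta kap del p c q.
Proof.
intros H Heta. assert (Hab := dw_lt H).
set (D := b - a). set (c := (a + b) / 2).
assert (HD : 0 < D) by (unfold D; lra).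
assert (HeD : 0 < eta * D) by (apply Rmult_lt_0_compat; lra).
assert (HeD2 : eta * D <= D / 16) by nra.
destruct (barrier_point L F g a b c (eta * D) H) as [k1 [Hk1 B1]]; [unfold c; lra|auto|].
destruct (barrier_point L _ _ (- b) (- a) (- c) (eta * D) (double_well_reflect H)) as [k2 [Hk2 B2]];
  [unfold c; lra|auto|].
(* one tilt for both wells, so that the slope bound is the same on both sides *)
set (kap := Rmin k1 k2).
assert (Hkap : 0 < kap) by now apply Rmin_glb_lt.
destruct (B1 kap) as [p [Hp1 [Hp2 [Hp3 Hp4]]]]; [split; [auto|apply Rmin_l]|].
destruct (B2 kap) as [q' [Hq1 [Hq2 [Hq3 Hq4]]]]; [split; [auto|apply Rmin_r]|].
set (q := - q') in *.
exists kap, (kap * D / 16), p, c, q.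
assert (HkD : 0 < kap * D) by now apply Rmult_lt_0_compat.
split; auto; try (unfold q, D in *; lra).
- intros r Hr. assert (hr : q' <= - r <= - c) by (unfold q in *; lra).
  assert (h := Hq4 (- r) hr).
  rewrite Ropp_involutive in h. replace (q - r) with (- r - q') by (unfold q; ring). exact h.
- intros s t Hs Ht.
  assert (Hqp : 7 / 8 * D <= q - p) by (unfold q, D in *; lra).
  assert (HFp : F p <= kap * D / 16).
  { apply Rle_trans with (1 := Hp3). replace (kap * D / 16) with (kap * (D / 16)) by field.
    apply Rmult_le_compat_l; lra. }
  assert (HFq : F q <= kap * D / 16).
  { apply Rle_trans with (1 := Hq3). replace (kap * D / 16) with (kap * (D / 16)) by field.
    apply Rmult_le_compat_l; unfold q in *; lra. }
  unfold slope. unfold Rdiv at 1. rewrite Rabs_mult, (Rabs_pos_eq (/ (q - p))).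
  2: { apply Rlt_le, Rinv_0_lt_compat; lra. }
  apply Rmult_le_reg_r with (q - p); [lra|].
  rewrite Rmult_assoc, Rinv_l, Rmult_1_r by lra.
  assert (HX : kap * (7 / 8 * D) <= kap * (q - p)) by (apply Rmult_le_compat_l; lra).
  apply Rabs_le. lra.
Qed.

(** Normalised distance to the well [e]: affine from 1 at [e - D] to 0 at [e],
    and constant beyond. *)
Definition weight (D e r : R) : R := Rmax 0 (Rmin 1 ((e - r) / D)).

Lemma weight_range (D e r : R) : 0 <= weight D e r <= 1.
Proof.
unfold weight. split; [apply Rmax_l|]. apply Rmax_lub; [lra|apply Rmin_l].
Qed.

Lemma weight_lipschitz (D e : R) : 0 < D -> lipschitz (/ D) (weight D e).
Proof.
intros HD x y. unfold weight.
replace (/ D * Rabs (x - y)) with (Rabs ((e - x) / D - (e - y) / D)).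
- unfold Rmax, Rmin; repeat destruct Rle_dec; unfold Rabs; repeat destruct Rcase_abs; lra.
- rewrite <- (Rabs_pos_eq (/ D)) by (apply Rlt_le, Rinv_0_lt_compat; lra).
  rewrite <- Rabs_mult, <- Rabs_Ropp. f_equal. field. lra.
Qed.

Lemma weight_small (D e q eta r : R) :
  0 < D -> 0 <= eta -> e - eta * D <= q -> q <= r -> weight D e r <= eta.
Proof.
intros HD He Hq Hr. unfold weight. apply Rmax_lub; auto.
apply Rle_trans with (1 := Rmin_r _ _). apply Rmult_le_reg_r with D; auto.
unfold Rdiv. rewrite Rmult_assoc, Rinv_l by lra. lra.
Qed.

Lemma weight_affine (D e r : R) : 0 < D -> e - D <= r <= e -> weight D e r = (e - r) / D.
Proof.
intros HD Hr. unfold weight.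
assert (H0 : 0 <= (e - r) / D) by (apply Rdiv_le_0_compat; lra).
assert (H1 : (e - r) / D <= 1).
{ apply Rmult_le_reg_r with D; auto. unfold Rdiv. rewrite Rmult_assoc, Rinv_l by lra. lra. }
rewrite Rmin_right, Rmax_right; lra.
Qed.

(** The trajectory shot from [c] towards [b] along the line with heights [s] at
    [p] and [t] at [q], with its forward and backward turning times truncated
    at [K]. *)
Record shot (F g : R -> R) (p c q K s t : R) (u u1 : R -> R) (T1 T2 : R) : Prop := {
  sh_traj : trajectory (fun r => g r - slope p q s t) u u1;
  sh_c : u 0 = c;
  sh_v : u1 0 = sqrt (2 * (F c - line p q s t c));
  sh_T1 : is_exit_time (fun y => u1 (- y)) K T1;
  sh_T2 : is_exit_time u1 K T2 }.
Arguments sh_traj {F g p c q K s t u u1 T1 T2} _.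
Arguments sh_c {F g p c q K s t u u1 T1 T2} _.
Arguments sh_v {F g p c q K s t u u1 T1 T2} _.
Arguments sh_T1 {F g p c q K s t u u1 T1 T2} _.
Arguments sh_T2 {F g p c q K s t u u1 T1 T2} _.

Lemma frame_barrier_right {L : R} {F g : R -> R} {a b eta kap del p c q : R} {s t : R} (r : R) :
  frame L F g a b eta kap del p c q -> - del <= s <= F p -> - del <= t <= F q ->
  c <= r <= q -> kap / 2 * (q - r) <= F r - line p q s t r.
Proof.
intros H Hs Ht Hr.
assert (h := fr_right H r Hr). assert (h2 := fr_slope H s t Hs Ht).
assert (h3 := fr_pc H). assert (h4 := fr_cq H).
rewrite line_from_right by lra.
apply Rabs_le_between in h2. nra.
Qed.

Lemma frame_barrier_left {L : R} {F g : R -> R} {a b eta kap del p c q : R} {s t : R} (r : R) :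
  frame L F g a b eta kap del p c q -> - del <= s <= F p -> - del <= t <= F q ->
  p <= r <= c -> kap / 2 * (r - p) <= F r - line p q s t r.
Proof.
intros H Hs Ht Hr.
assert (h := fr_left H r Hr). assert (h2 := fr_slope H s t Hs Ht).
unfold line. apply Rabs_le_between in h2. nra.
Qed.

Lemma frame_height {L : R} {F g : R -> R} {a b eta kap del p c q : R} {s t : R} :
  frame L F g a b eta kap del p c q -> - del <= s <= F p -> - del <= t <= F q ->
  0 < F c - line p q s t c.
Proof.
intros H Hs Ht.
assert (h := frame_barrier_right c H Hs Ht).
assert (h3 := fr_cq H). assert (h4 := fr_kap H). specialize (h ltac:(lra)).
assert (0 < kap / 2 * (q - c)) by (apply Rmult_lt_0_compat; lra). lra.
Qed.

Lemma lipschitz_minus_const (L lam : R) (g : R -> R) :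
  lipschitz L g -> lipschitz L (fun r => g r - lam).
Proof.
intros Hg r s. replace (g r - lam - (g s - lam)) with (g r - g s) by ring. apply Hg.
Qed.

Lemma shot_exists {L : R} {F g : R -> R} {a b eta kap del p c q : R} (K : R) {s t : R} :
  frame L F g a b eta kap del p c q -> 0 < K -> - del <= s <= F p -> - del <= t <= F q ->
  exists u u1 T1 T2, shot F g p c q K s t u u1 T1 T2.
Proof.
intros H HK Hs Ht.
destruct (trajectory_exists L (fun r => g r - slope p q s t) c (sqrt (2 * (F c - line p q s t c)))
  (dw_L (fr_dw H)) (lipschitz_minus_const _ _ _ (dw_lip (fr_dw H)))) as [u [u1 [Hu [E0 E1]]]].
assert (Cu1 : forall y, continuous u1 y) by (intros y; apply (is_derive_continuous _ _ _ (traj_u1 Hu y))).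
assert (Hv : 0 < u1 0).
{ rewrite E1. apply sqrt_lt_R0. assert (h := frame_height H Hs Ht). lra. }
destruct (exit_time_exists u1 K Cu1 Hv HK) as [T2 HT2].
destruct (exit_time_exists (fun y => u1 (- y)) K) as [T1 HT1]; auto.
{ intros y. apply (continuous_comp (fun y => - y) u1); auto.
  apply (continuous_opp (V := R_NormedModule)), continuous_id. }
{ now rewrite Ropp_0. }
exists u, u1, T1, T2. now split.
Qed.

Lemma shot_energy {L : R} {F g : R -> R} {a b eta kap del p c q K s t : R}
  {u u1 : R -> R} {T1 T2 : R} :
  frame L F g a b eta kap del p c q -> - del <= s <= F p -> - del <= t <= F q ->
  shot F g p c q K s t u u1 T1 T2 ->
  forall y, u1 y ^ 2 = 2 * (F (u y) - line p q s t (u y)).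
Proof.
intros H Hs Ht S y.
set (E := fun y => u1 y ^ 2 - 2 * (F (u y) - line p q s t (u y))).
assert (HE : E y = E 0).
{ destruct (MVT_gen E 0 y (fun _ => 0)) as [x [_ Ex]].
  - intros x _. unfold E, line.
    assert (A1 := traj_u (sh_traj S) x). assert (A2 := traj_u1 (sh_traj S) x).
    assert (A3 := dw_derive (fr_dw H) (u x)).
    auto_derive.
    + repeat split; auto; eexists; eassumption.
    + rewrite (is_derive_unique (fun x0 : R => u x0) _ _ A1), (is_derive_unique (fun x0 : R => u1 x0) _ _ A2),
        (is_derive_unique (fun x0 : R => F x0) _ _ A3).
      unfold slope. ring.
  - intros x _. apply continuity_pt_filterlim.
    assert (A1 := traj_u (sh_traj S) x). assert (A2 := traj_u1 (sh_traj S) x).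
    assert (A3 := dw_derive (fr_dw H) (u x)).
    apply (ex_derive_continuous (V := R_NormedModule)). unfold E, line. auto_derive.
    repeat split; auto; eexists; eassumption.
  - lra. }
assert (E0 : E 0 = 0).
{ unfold E. rewrite (sh_v S), (sh_c S).
  assert (h := frame_height H Hs Ht).
  rewrite pow2_sqrt by lra. ring. }
unfold E in HE at 1. lra.
Qed.

Lemma shot_right_half {L : R} {F g : R -> R} {a b eta kap del p c q K s t : R}
  {u u1 : R -> R} {T1 T2 : R} :
  frame L F g a b eta kap del p c q -> - del <= s <= F p -> - del <= t <= F q ->
  shot F g p c q K s t u u1 T1 T2 ->
  half_transition L (fun r => g r - slope p q s t) (fun r => F r - line p q s t r) kap c q u u1.
Proof.
intros H Hs Ht S. split.
- apply (dw_L (fr_dw H)).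
- apply lipschitz_minus_const, (dw_lip (fr_dw H)).
- apply S.
- apply S.
- rewrite (sh_v S). apply sqrt_lt_R0.
  assert (h := frame_height H Hs Ht). lra.
- intros y. now apply (shot_energy H Hs Ht S).
- apply H.
- apply H.
- intros r Hr. now apply (frame_barrier_right r H).
Qed.

Lemma shot_left_half {L : R} {F g : R -> R} {a b eta kap del p c q K s t : R}
  {u u1 : R -> R} {T1 T2 : R} :
  frame L F g a b eta kap del p c q -> - del <= s <= F p -> - del <= t <= F q ->
  shot F g p c q K s t u u1 T1 T2 ->
  half_transition L (fun r => - (g (- r) - slope p q s t)) (fun r => F (- r) - line p q s t (- r))
    kap (- c) (- p) (fun y => - u (- y)) (fun y => u1 (- y)).
Proof.
intros H Hs Ht S. split.
- apply (dw_L (fr_dw H)).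
- intros x y. replace (- (g (- x) - slope p q s t) - - (g (- y) - slope p q s t)) with (g (- y) - g (- x)) by ring.
  apply Rle_trans with (1 := dw_lip (fr_dw H) (- y) (- x)). right. do 2 f_equal. ring.
- apply (trajectory_reflect (fun r => g r - slope p q s t)), S.
- rewrite Ropp_0. f_equal. apply S.
- rewrite Ropp_0, (sh_v S). apply sqrt_lt_R0.
  assert (h := frame_height H Hs Ht). lra.
- intros y. rewrite !Ropp_involutive.
  now apply (shot_energy H Hs Ht S).
- assert (h := fr_pc H). lra.
- apply H.
- intros r Hr. assert (h := frame_barrier_left (- r) H Hs Ht ltac:(lra)). lra.
Qed.

(** * Balancing the two wells *)

(** Time integrals of the normalised distance to [b] on [[0, T]] and to [a] on
    [[- T, 0]]. The second is written for the reflected trajectory, whose well is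
    at [- a]. *)
Definition right_lag (a b : R) (u : R -> R) (T : R) : R :=
  RInt (fun y => weight (b - a) b (u y)) 0 T.

Definition left_lag (a b : R) (u : R -> R) (T : R) : R :=
  RInt (fun y => weight (b - a) (- a) (- u (- y))) 0 T.

Lemma slope_close (p q s t s0 t0 d : R) :
  p < q -> Rabs (s - s0) < d -> Rabs (t - t0) < d ->
  Rabs (slope p q s t - slope p q s0 t0) <= 2 * d / (q - p).
Proof.
intros Hpq Hs Ht. unfold slope.
replace ((t - s) / (q - p) - (t0 - s0) / (q - p)) with (((t - t0) - (s - s0)) * / (q - p)) by (field; lra).
rewrite Rabs_mult, (Rabs_pos_eq (/ (q - p))) by (apply Rlt_le, Rinv_0_lt_compat; lra).
apply Rmult_le_compat_r; [apply Rlt_le, Rinv_0_lt_compat; lra|].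
apply Rabs_def2 in Hs. apply Rabs_def2 in Ht. apply Rabs_le. lra.
Qed.

Lemma line_close (p q s t s0 t0 d r : R) :
  p < q -> p <= r <= q -> Rabs (s - s0) < d -> Rabs (t - t0) < d ->
  Rabs (line p q s t r - line p q s0 t0 r) <= 3 * d.
Proof.
intros Hpq Hr Hs Ht.
assert (h := slope_close p q s t s0 t0 d Hpq Hs Ht).
replace (line p q s t r - line p q s0 t0 r) with
  ((s - s0) + (slope p q s t - slope p q s0 t0) * (r - p)) by (unfold line, slope; field; lra).
apply Rle_trans with (1 := Rabs_triang _ _).
rewrite Rabs_mult, (Rabs_pos_eq (r - p)) by lra.
assert (h2 : Rabs (slope p q s t - slope p q s0 t0) * (r - p) <= 2 * d / (q - p) * (q - p)).
{ apply Rmult_le_compat; try lra. apply Rabs_pos. }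
replace (2 * d / (q - p) * (q - p)) with (2 * d) in h2 by (field; lra). lra.
Qed.

Lemma shot_stable {L : R} {F g : R -> R} {a b eta kap del p c q K s0 t0 : R}
  {u u1 : R -> R} {T1 T2 : R} (e : R) :
  frame L F g a b eta kap del p c q -> - del <= s0 <= F p -> - del <= t0 <= F q ->
  shot F g p c q K s0 t0 u u1 T1 T2 -> 0 < e ->
  exists d, 0 < d /\ forall s t w w1 S1 S2,
    - del <= s <= F p -> - del <= t <= F q ->
    Rabs (s - s0) < d -> Rabs (t - t0) < d -> shot F g p c q K s t w w1 S1 S2 ->
    Rabs (S1 - T1) < e /\ Rabs (S2 - T2) < e /\
    Rabs (left_lag a b w S1 - left_lag a b u T1) < e /\
    Rabs (right_lag a b w S2 - right_lag a b u T2) < e.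
Proof.
intros H Hs0 Ht0 S He.
assert (Hab := dw_lt (fr_dw H)).
assert (Hpc := fr_pc H). assert (Hcq := fr_cq H).
assert (HM : 0 <= / (b - a)) by (apply Rlt_le, Rinv_0_lt_compat; lra).
destruct (ht_stable _ (weight (b - a) b)
  (shot_right_half H Hs0 Ht0 S) (sh_T2 S) HM
  (weight_lipschitz (b - a) b ltac:(lra)) (weight_range _ _) e He) as [d1 [Hd1 HR]].
destruct (ht_stable _ (weight (b - a) (- a))
  (shot_left_half H Hs0 Ht0 S) (sh_T1 S) HM
  (weight_lipschitz (b - a) (- a) ltac:(lra)) (weight_range _ _) e He) as [d2 [Hd2 HL]].
set (d3 := Rmin d1 d2).
assert (Hd3 : 0 < d3) by now apply Rmin_glb_lt.
assert (H31 : d3 <= d1) by apply Rmin_l. assert (H32 : d3 <= d2) by apply Rmin_r.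
destruct (trajectory_close L (slope p q s0 t0) (u1 0) K d3 g u u1 (dw_L (fr_dw H)) (dw_lip (fr_dw H))
  Hd3 (sh_traj S) eq_refl) as [d4 [Hd4 HT]].
assert (Hh := frame_height H Hs0 Ht0).
destruct (continuous_eps sqrt (2 * (F c - line p q s0 t0 c)) (continuous_sqrt _) d4 Hd4) as [d5 [Hd5 Hsq]].
set (d := Rmin (d4 * (q - p) / 4) (d5 / 12)).
assert (Hd : 0 < d).
{ apply Rmin_glb_lt; [|lra]. apply Rdiv_lt_0_compat; [|lra]. apply Rmult_lt_0_compat; lra. }
assert (Hda : d <= d4 * (q - p) / 4) by apply Rmin_l. assert (Hdb : d <= d5 / 12) by apply Rmin_r.
exists d. split; auto. intros s t w w1 S1 S2 Hs Ht Ds Dt S'.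
assert (Hsl : Rabs (slope p q s t - slope p q s0 t0) < d4).
{ apply Rle_lt_trans with (1 := slope_close p q s t s0 t0 d ltac:(lra) Ds Dt).
  apply Rmult_lt_reg_r with (q - p); [lra|].
  replace (2 * d / (q - p) * (q - p)) with (2 * d) by (field; lra). 
  assert (0 < d4 * (q - p)) by (apply Rmult_lt_0_compat; lra). lra. }
assert (Hv : Rabs (w1 0 - u1 0) < d4).
{ rewrite (sh_v S), (sh_v S'). apply Hsq.
  replace (2 * (F c - line p q s t c) - 2 * (F c - line p q s0 t0 c)) with
    (- (2 * (line p q s t c - line p q s0 t0 c))) by ring.
  rewrite Rabs_Ropp, Rabs_mult, (Rabs_pos_eq 2) by lra.
  assert (h := line_close p q s t s0 t0 d c ltac:(lra) ltac:(lra) Ds Dt). lra. }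
assert (Hclose : forall y, Rabs y <= K -> Rabs (w y - u y) < d3 /\ Rabs (w1 y - u1 y) < d3).
{ apply (HT (slope p q s t) (w1 0)); auto.
  - apply S'.
  - rewrite (sh_c S), (sh_c S'). reflexivity. }
assert (HK : 0 < K) by (destruct (sh_T1 S); lra).
assert (Cw : forall y, continuous w y).
{ intros y. apply (is_derive_continuous _ _ _ (traj_u (sh_traj S') y)). }
destruct (HR w w1 S2 Cw (sh_T2 S')) as [R1 R2].
{ intros y Hy. destruct (Hclose y) as [C1 C2]; [rewrite Rabs_pos_eq; lra|]. lra. }
destruct (HL (fun y => - w (- y)) (fun y => w1 (- y)) S1) as [L1 L2].
{ intros y. apply (continuous_opp (V := R_NormedModule) (fun y => w (- y))).
  apply (continuous_comp (fun y => - y) w); auto.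
  apply (continuous_opp (V := R_NormedModule)), continuous_id. }
{ apply S'. }
{ intros y Hy. destruct (Hclose (- y)) as [C1 C2]; [rewrite Rabs_Ropp, Rabs_pos_eq; lra|].
  replace (- w (- y) - - u (- y)) with (- (w (- y) - u (- y))) by ring. rewrite Rabs_Ropp. lra. }
unfold left_lag, right_lag. auto.
Qed.

(** Each lag is a bounded time plus at most the fraction [eta] of [K]. *)
Lemma shot_lag_bounds {L : R} {F g : R -> R} {a b eta kap del p c q K s t : R}
  {u u1 : R -> R} {T1 T2 : R} :
  frame L F g a b eta kap del p c q -> 0 <= eta -> - del <= s <= F p -> - del <= t <= F q ->
  shot F g p c q K s t u u1 T1 T2 ->
  0 <= left_lag a b u T1 <= barrier_time kap (- c) (- p) + eta * K /\
  0 <= right_lag a b u T2 <= barrier_time kap c q + eta * K.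
Proof.
intros H Heta Hs Ht S.
assert (Hab := dw_lt (fr_dw H)). assert (Hp := fr_p H). assert (Hq := fr_q H).
split.
- apply (ht_weight_bound eta (weight (b - a) (- a))
    (shot_left_half H Hs Ht S) (sh_T1 S)); auto.
  + apply (lipschitz_continuous (/ (b - a))), weight_lipschitz. lra.
  + apply weight_range.
  + intros r Hr. apply (weight_small _ _ (- p)); lra.
- apply (ht_weight_bound eta (weight (b - a) b)
    (shot_right_half H Hs Ht S) (sh_T2 S)); auto.
  + apply (lipschitz_continuous (/ (b - a))), weight_lipschitz. lra.
  + apply weight_range.
  + intros r Hr. apply (weight_small _ _ q); lra.
Qed.

Lemma choice_on (A B : Type) (P : A -> Prop) (Q : A -> B -> Prop) :
  inhabited B -> (forall x, P x -> exists y, Q x y) -> exists f, forall x, P x -> Q x (f x).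
Proof.
intros HB HQ. exists (fun x => epsilon HB (Q x)). intros x Hx. apply epsilon_spec, HQ, Hx.
Qed.

(** On the side [s = - del] of the rectangle the trajectory never turns
    backward, on the side [s = F p] it turns within the barrier time, and
    likewise for [t]; so the theorem of Poincare and Miranda distributes the
    total time [K] between the two wells in any prescribed proportion. *)
Lemma balanced_shot (L : R) (F g : R -> R) (a b eta kap del p c q K theta C : R) :
  frame L F g a b eta kap del p c q -> 0 <= eta -> 0 < K ->
  barrier_time kap (- c) (- p) <= C -> barrier_time kap c q <= C ->
  2 * C + eta * K < theta * K -> 2 * C + eta * K < (1 - theta) * K ->
  exists s t u u1 T1 T2, - del <= s <= F p /\ - del <= t <= F q /\
    shot F g p c q K s t u u1 T1 T2 /\
    T1 - left_lag a b u T1 + right_lag a b u T2 = (1 - theta) * K /\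
    T2 - right_lag a b u T2 + left_lag a b u T1 = theta * K.
Proof.
intros H Heta HK HC1 HC2 Hth1 Hth2.
assert (Hdel := fr_del H). assert (Hpc := fr_pc H). assert (Hcq := fr_cq H).
assert (HFp := double_well_nonneg p (fr_dw H)).
assert (HFq := double_well_nonneg q (fr_dw H)).
assert (HC : 0 <= C).
{ apply Rle_trans with (2 := HC2). unfold barrier_time.
  assert (0 <= sqrt ((q - c) / kap)) by apply sqrt_pos. lra. }
destruct (choice_on (R * R) ((R -> R) * (R -> R) * (R * R))
  (fun st => - del <= fst st <= F p /\ - del <= snd st <= F q)
  (fun st d => shot F g p c q K (fst st) (snd st) (fst (fst d)) (snd (fst d)) (fst (snd d)) (snd (snd d))))
  as [data Hdata].
{ exact (inhabits ((fun _ => 0, fun _ => 0), (0, 0))). }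
{ intros [s t] [Hs Ht]. simpl in *.
  destruct (shot_exists K H HK Hs Ht) as [u [u1 [T1 [T2 S]]]].
  exists ((u, u1), (T1, T2)). exact S. }
set (uu := fun s t => fst (fst (data (s, t)))).
set (vv := fun s t => snd (fst (data (s, t)))).
set (TT1 := fun s t => fst (snd (data (s, t)))).
set (TT2 := fun s t => snd (snd (data (s, t)))).
assert (HS : forall s t, - del <= s <= F p -> - del <= t <= F q ->
   shot F g p c q K s t (uu s t) (vv s t) (TT1 s t) (TT2 s t)).
{ intros s t Hs Ht. apply (Hdata (s, t)). auto. }
set (f1 := fun s t => TT1 s t - left_lag a b (uu s t) (TT1 s t) + right_lag a b (uu s t) (TT2 s t) - (1 - theta) * K).
set (f2 := fun s t => TT2 s t - right_lag a b (uu s t) (TT2 s t) + left_lag a b (uu s t) (TT1 s t) - theta * K).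
destruct (poincare_miranda (- del) (F p) (- del) (F q) f1 f2) as [s [t [Hs [Ht [E1 E2]]]]]; try lra.
- intros s t Hs Ht e He.
  destruct (shot_stable (e / 3) H Hs Ht (HS s t Hs Ht) ltac:(lra)) as [d [Hd Hd2]].
  exists d; split; auto. intros s' t' Hs' Ht' Ds Dt.
  destruct (Hd2 _ _ _ _ _ _ Hs' Ht' Ds Dt (HS s' t' Hs' Ht')) as [D1 [D2 [D3 D4]]].
  unfold f1. apply Rabs_def2 in D1. apply Rabs_def2 in D3. apply Rabs_def2 in D4. apply Rabs_def1; lra.
- intros s t Hs Ht e He.
  destruct (shot_stable (e / 3) H Hs Ht (HS s t Hs Ht) ltac:(lra)) as [d [Hd Hd2]].
  exists d; split; auto. intros s' t' Hs' Ht' Ds Dt.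
  destruct (Hd2 _ _ _ _ _ _ Hs' Ht' Ds Dt (HS s' t' Hs' Ht')) as [D1 [D2 [D3 D4]]].
  unfold f2. apply Rabs_def2 in D2. apply Rabs_def2 in D3. apply Rabs_def2 in D4. apply Rabs_def1; lra.
- intros t Ht. set (s := - del). assert (Hs : - del <= s <= F p) by (unfold s; lra).
  assert (S := HS s t Hs Ht).
  assert (B := shot_lag_bounds H Heta Hs Ht S).
  assert (E : TT1 s t = K).
  { apply (ht_no_exit (shot_left_half H Hs Ht S) (sh_T1 S)).
    intros r Hr. assert (HF := double_well_nonneg (- r) (fr_dw H)).
    unfold line, slope. assert (0 <= (t - s) / (q - p)) by (apply Rdiv_le_0_compat; unfold s; lra).
    assert (Hs0 : s < 0) by (unfold s; lra). nra. }
  unfold f1. rewrite E in *. lra.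
- intros t Ht. set (s := F p). assert (Hs : - del <= s <= F p) by (unfold s; lra).
  assert (S := HS s t Hs Ht).
  assert (B := shot_lag_bounds H Heta Hs Ht S).
  assert (E : TT1 s t <= barrier_time kap (- c) (- p)).
  { apply (ht_exit_early (shot_left_half H Hs Ht S) (sh_T1 S)).
    simpl. rewrite Ropp_involutive, line_at_left. unfold s; ring. }
  unfold f1. lra.
- intros s Hs. set (t := - del). assert (Ht : - del <= t <= F q) by (unfold t; lra).
  assert (S := HS s t Hs Ht).
  assert (B := shot_lag_bounds H Heta Hs Ht S).
  assert (E : TT2 s t = K).
  { apply (ht_no_exit (shot_right_half H Hs Ht S) (sh_T2 S)).
    intros r Hr. assert (HF := double_well_nonneg r (fr_dw H)).
    rewrite line_from_right by lra. unfold slope.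
    assert (0 <= (s - t) / (q - p)) by (apply Rdiv_le_0_compat; unfold t; lra).
    replace ((t - s) / (q - p)) with (- ((s - t) / (q - p))) by (field; lra).
    assert (Ht0 : t < 0) by (unfold t; lra). nra. }
  unfold f2. rewrite E in *. lra.
- intros s Hs. set (t := F q). assert (Ht : - del <= t <= F q) by (unfold t; lra).
  assert (S := HS s t Hs Ht).
  assert (B := shot_lag_bounds H Heta Hs Ht S).
  assert (E : TT2 s t <= barrier_time kap c q).
  { apply (ht_exit_early (shot_right_half H Hs Ht S) (sh_T2 S)).
    simpl. rewrite line_from_right by lra. unfold t; ring. }
  unfold f2. lra.
- exists s, t, (uu s t), (vv s t), (TT1 s t), (TT2 s t).
  unfold f1 in E1. unfold f2 in E2. repeat split; try lra; try apply (HS s t Hs Ht).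
Qed.

(** A trajectory that turns outside [[a, b]] would do so where [F = 0], so the
    line would be nonnegative along its last stretch, against the energy
    identity. *)
Lemma shot_confined {L : R} {F g : R -> R} {a b eta kap del p c q K s t : R}
  {u u1 : R -> R} {T1 T2 : R} :
  frame L F g a b eta kap del p c q -> - del <= s <= F p -> - del <= t <= F q ->
  shot F g p c q K s t u u1 T1 T2 -> T1 < K -> T2 < K ->
  a <= u (- T1) /\ u T2 <= b.
Proof.
intros H Hs Ht S HT1K HT2K.
assert (En := shot_energy H Hs Ht S).
assert (Hpc := fr_pc H). assert (Hcq := fr_cq H). assert (Hap := fr_ap H). assert (Hqb := fr_qb H).
destruct (sh_T1 S) as [HT1 [P1 Z1]]. destruct (sh_T2 S) as [HT2 [P2 Z2]].
specialize (Z1 HT1K). specialize (Z2 HT2K).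
assert (E1 := En (- T1)). rewrite Z1 in E1. assert (E2 := En T2). rewrite Z2 in E2.
assert (N1 := double_well_nonneg (u (- T1)) (fr_dw H)).
assert (N2 := double_well_nonneg (u T2) (fr_dw H)).
assert (Cu : forall y, continuous u y).
{ intros y. apply (is_derive_continuous _ _ _ (traj_u (sh_traj S) y)). }
assert (Hl : forall r r', line p q s t r' - line p q s t r = (t - s) / (q - p) * (r' - r)).
{ intros r r'. unfold line, slope. ring. }
assert (Hc := sh_c S).
assert (R1 : u (- T1) <= c).
{ assert (h := ht_range T1 (shot_left_half H Hs Ht S)
    (sh_T1 S) ltac:(lra)). simpl in h. lra. }
assert (R2 : c <= u T2).
{ exact (ht_range T2 (shot_right_half H Hs Ht S)
    (sh_T2 S) ltac:(lra)). }
assert (E12 := Hl (u (- T1)) (u T2)).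
set (lam := (t - s) / (q - p)) in *.
split; apply Rnot_lt_le; intros Hlt.
- destruct (ivt_value u (- T1) 0 ((u (- T1) + a) / 2)) as [y [Hy Ey]]; [auto|lra|lra|].
  assert (Hy1 : y <> - T1) by (intros ->; lra).
  assert (F0 := dw_left (fr_dw H) (u (- T1)) ltac:(lra)).
  assert (Fy := dw_left (fr_dw H) (u y) ltac:(lra)).
  assert (Ly := Hl (u (- T1)) (u y)).
  assert (Hv : 0 < u1 y) by (rewrite <- (Ropp_involutive y); apply P1; lra).
  assert (Ey2 := En y).
  assert (0 <= lam) by nra.
  assert (0 <= lam * (u y - u (- T1))) by (apply Rmult_le_pos; lra). nra.
- destruct (ivt_value u 0 T2 ((u T2 + b) / 2)) as [y [Hy Ey]]; [auto|lra|lra|].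
  assert (Hy1 : y <> T2) by (intros ->; lra).
  assert (F0 := dw_right (fr_dw H) (u T2) ltac:(lra)).
  assert (Fy := dw_right (fr_dw H) (u y) ltac:(lra)).
  assert (Ly := Hl (u T2) (u y)).
  assert (Hv : 0 < u1 y) by (apply P2; lra).
  assert (Ey2 := En y).
  assert (lam <= 0) by nra.
  assert (0 <= lam * (u y - u T2)) by nra. nra.
Qed.

(** * Half periods *)

(** Half a period of the rescaled solution, between the turning points 0 and
    [K], with values in [[a, b]] and mean [rs]; during the fraction
    [(b - rs) / (b - a)] of the time its distance to [a] is at most [eta * K] in
    the integral. *)
Record half_period (F g : R -> R) (a b rs K eta lam : R) (w w1 : R -> R) : Prop := {
  hp_traj : trajectory (fun r => g r - lam) w w1;
  hp_min : w1 0 = 0;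
  hp_max : w1 K = 0;
  hp_range : forall y, 0 <= y <= K -> a <= w y <= b;
  hp_osc : w 0 < w K;
  hp_mean : RInt w 0 K = rs * K;
  hp_near : RInt (fun y => w y - a) 0 ((b - rs) / (b - a) * K) <= eta * K }.

Arguments hp_traj {F g a b rs K eta lam w w1} _.
Arguments hp_min {F g a b rs K eta lam w w1} _.
Arguments hp_max {F g a b rs K eta lam w w1} _.
Arguments hp_range {F g a b rs K eta lam w w1} _ _ _.
Arguments hp_osc {F g a b rs K eta lam w w1} _.
Arguments hp_mean {F g a b rs K eta lam w w1} _.
Arguments hp_near {F g a b rs K eta lam w w1} _.

(** A balanced shot, started at its left turning point, is a half period: the
    balance of times and lags is exactly the condition on the mean. *)
Lemma half_period_of_shot (L : R) (F g : R -> R) (a b eta kap del p c q K s t rs err : R)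
  (u u1 : R -> R) (T1 T2 : R) :
  frame L F g a b eta kap del p c q -> - del <= s <= F p -> - del <= t <= F q ->
  a < rs < b ->
  shot F g p c q K s t u u1 T1 T2 ->
  T1 - left_lag a b u T1 + right_lag a b u T2 = (b - rs) / (b - a) * K ->
  T2 - right_lag a b u T2 + left_lag a b u T1 = (rs - a) / (b - a) * K ->
  (b - a) * left_lag a b u T1 <= err * K -> (b - a) * right_lag a b u T2 <= err * K ->
  half_period F g a b rs K err (slope p q s t) (fun y => u (- T1 + y)) (fun y => u1 (- T1 + y)).
Proof.
intros H Hs Ht Hrs S B1 B2 E1 E2.
assert (Hab := dw_lt (fr_dw H)).
set (D := b - a) in *. assert (HD : 0 < D) by (unfold D; lra).
assert (HT1 := sh_T1 S). assert (HT2 := sh_T2 S).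
assert (HK : T1 + T2 = K).
{ replace K with ((b - rs) / D * K + (rs - a) / D * K); [lra|]. unfold D; field. unfold D in HD; lra. }
assert (HT1K : T1 < K) by (destruct HT2; lra). assert (HT2K : T2 < K) by (destruct HT1; lra).
destruct (shot_confined H Hs Ht S HT1K HT2K) as [Ha Hb].
assert (HR := shot_right_half H Hs Ht S).
assert (HL := shot_left_half H Hs Ht S).
assert (Cu : forall y, continuous u y) by apply (proj1 (ht_continuous HR)).
assert (T1pos : 0 < T1) by (destruct HT1; lra). assert (T2pos : 0 < T2) by (destruct HT2; lra).
assert (Hc := sh_c S).
assert (Hleft : forall y, - T1 <= y <= 0 -> a <= u y <= c).
{ intros y Hy. split.
  - apply Rle_trans with (1 := Ha). destruct (Req_dec y (- T1)) as [->|Hn]; [apply Rle_refl|].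
    assert (h := trajectory_increasing (- y) T1 (ht_traj HL) HT1 ltac:(lra) ltac:(lra)).
    simpl in h. rewrite Ropp_involutive in h. lra.
  - assert (h := ht_range (- y) HL HT1 ltac:(lra)). simpl in h.
    rewrite Ropp_involutive in h. lra. }
assert (Hright : forall y, 0 <= y <= T2 -> c <= u y <= b).
{ intros y Hy. split.
  - exact (ht_range y HR HT2 ltac:(lra)).
  - apply Rle_trans with (2 := Hb). destruct (Req_dec y T2) as [->|Hn]; [apply Rle_refl|].
    apply Rlt_le. exact (trajectory_increasing y T2 (ht_traj HR) HT2 ltac:(lra) ltac:(lra)). }
assert (Hcab : a < c < b).
{ assert (h1 := fr_ap H). assert (h2 := fr_pc H). assert (h3 := fr_cq H). assert (h4 := fr_qb H). lra. }
assert (Hrange : forall y, - T1 <= y <= T2 -> a <= u y <= b).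
{ intros y Hy. destruct (Rle_or_lt y 0) as [h|h].
  - assert (h2 := Hleft y ltac:(lra)). lra.
  - assert (h2 := Hright y ltac:(lra)). lra. }
(* the two lags are the integrals of the distances to the wells *)
assert (I1 : RInt (fun y => u y - a) (- T1) 0 = D * left_lag a b u T1).
{ assert (J1 : D * left_lag a b u T1 = RInt (fun y => u (- y) - a) 0 T1).
  { unfold left_lag. rewrite <- RInt_mult_l.
    - apply RInt_congr. intros y Hy. rewrite Rmin_left, Rmax_right in Hy by lra.
      assert (h := Hleft (- y) ltac:(lra)).
      fold D. rewrite weight_affine by (unfold D; lra). field. lra.
    - apply ex_RInt_cont. intros y. apply (continuous_comp (fun y => - u (- y)) (weight (b - a) (- a))).
      + apply (proj1 (ht_continuous HL)).
      + apply (lipschitz_continuous (/ D)), weight_lipschitz. exact HD. }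
  rewrite J1, (RInt_flip (fun y => u y - a)), Ropp_0; auto.
  intros y. apply (continuous_minus (V := R_NormedModule)); auto. apply continuous_const. }
assert (I2 : RInt (fun y => b - u y) 0 T2 = D * right_lag a b u T2).
{ unfold right_lag. rewrite <- RInt_mult_l.
  - apply RInt_congr. intros y Hy. rewrite Rmin_left, Rmax_right in Hy by lra.
    assert (h := Hright y ltac:(lra)).
    fold D. rewrite weight_affine by (unfold D; lra). field. lra.
  - apply ex_RInt_cont. intros y. apply (continuous_comp u (weight (b - a) b)); auto.
    apply (lipschitz_continuous (/ D)), weight_lipschitz. exact HD. }
assert (Cua : forall y, continuous (fun y => u y - a) y).
{ intros y. apply (continuous_minus (V := R_NormedModule)); auto. apply continuous_const. }
rewrite (RInt_sub_cst u a _ _ Cu) in I1. rewrite (RInt_cst_sub u b _ _ Cu) in I2.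
split.
- apply (trajectory_shift (fun r => g r - slope p q s t)), S.
- rewrite Rplus_0_r. apply HT1. exact HT1K.
- replace (- T1 + K) with T2 by lra. apply HT2. exact HT2K.
- intros y Hy. apply Hrange. lra.
- rewrite Rplus_0_r. replace (- T1 + K) with T2 by lra.
  assert (h1 : u (- T1) < u 0).
  { assert (h := trajectory_increasing 0 T1 (ht_traj HL) HT1 ltac:(lra) ltac:(lra)).
    simpl in h. rewrite Ropp_0 in h. lra. }
  assert (h2 : u 0 < u T2) by exact (trajectory_increasing 0 T2 (ht_traj HR) HT2 ltac:(lra) ltac:(lra)).
  lra.
- rewrite (RInt_translate u) by auto. rewrite Rplus_0_r. replace (- T1 + K) with T2 by lra.
  rewrite <- (RInt_split u (- T1) 0 T2) by now apply ex_RInt_cont.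
  set (lL := left_lag a b u T1) in *. set (lR := right_lag a b u T2) in *.
  set (U1 := RInt u (- T1) 0) in *. set (U2 := RInt u 0 T2) in *.
  assert (M1 : D * T1 - D * lL + D * lR = (b - rs) * K).
  { replace ((b - rs) * K) with (D * ((b - rs) / D * K)) by (field; lra). rewrite <- B1. ring. }
  assert (M2 : D * T2 - D * lR + D * lL = (rs - a) * K).
  { replace ((rs - a) * K) with (D * ((rs - a) / D * K)) by (field; lra). rewrite <- B2. ring. }
  assert (V1 : U1 = D * lL + a * T1) by lra. assert (V2 : U2 = b * T2 - D * lR) by lra.
  rewrite V1, V2. apply Rmult_eq_reg_l with D; [|lra].
  replace (D * (D * lL + a * T1 + (b * T2 - D * lR))) with
    (a * (D * T1) + b * (D * T2) + D * (D * lL - D * lR)) by ring.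
  replace (D * T1) with ((b - rs) * K + D * lL - D * lR) by lra.
  replace (D * T2) with ((rs - a) * K + D * lR - D * lL) by lra.
  unfold D. ring.
- rewrite (RInt_translate (fun y => u y - a)) by auto. fold D. rewrite Rplus_0_r.
  rewrite <- B1. set (lL := left_lag a b u T1) in *. set (lR := right_lag a b u T2) in *.
  replace (- T1 + (T1 - lL + lR)) with (lR - lL) by ring.
  assert (I1' : RInt (fun y => u y - a) (- T1) 0 = D * lL).
  { rewrite (RInt_sub_cst u a _ _ Cu). exact I1. }
  assert (Hfrac : 0 < (b - rs) / D * K).
  { apply Rmult_lt_0_compat; [|lra]. apply Rdiv_lt_0_compat; lra. }
  assert (Hfrac2 : 0 < (rs - a) / D * K).
  { apply Rmult_lt_0_compat; [|lra]. apply Rdiv_lt_0_compat; lra. }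
  destruct (Rle_or_lt lR lL) as [Hlag|Hlag].
  + apply Rle_trans with (2 := E1). rewrite <- I1'.
    rewrite <- (RInt_split (fun y => u y - a) (- T1) (lR - lL) 0) by now apply ex_RInt_cont.
    assert (0 <= RInt (fun y => u y - a) (lR - lL) 0); [|lra].
    apply RInt_ge_0; [lra|now apply ex_RInt_cont|]. intros y Hy.
    assert (h := Hrange y ltac:(lra)). lra.
  + apply Rle_trans with (2 := E2).
    rewrite <- (RInt_split (fun y => u y - a) (- T1) 0 (lR - lL)) by now apply ex_RInt_cont.
    rewrite I1'.
    assert (RInt (fun y => u y - a) 0 (lR - lL) <= RInt (fun _ => D) 0 (lR - lL)).
    { apply RInt_le; [lra|now apply ex_RInt_cont|apply ex_RInt_const|]. intros y Hy.
      assert (h := Hrange y ltac:(lra)). unfold D. lra. }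
    rewrite RInt_cst in *. lra.
Qed.

(** The length [K0] depends on the double well, on the mean and on the
    tolerance [eta] only; this is what makes the threshold for [eps / omega^2]
    uniform. *)
Theorem half_period_exists (L : R) (F g : R -> R) (a b rs eta : R) :
  double_well L F g a b -> a < rs < b -> 0 < eta ->
  exists K0, 0 < K0 /\ forall K, K0 <= K ->
    exists lam w w1, half_period F g a b rs K eta lam w w1.
Proof.
intros H Hrs Heta. assert (Hab := dw_lt H).
set (D := b - a). assert (HD : 0 < D) by (unfold D; lra).
set (theta := (rs - a) / D).
assert (Hth : 0 < theta) by (apply Rdiv_lt_0_compat; lra).
assert (Hth1 : 1 - theta = (b - rs) / D) by (unfold theta, D; field; unfold D in HD; lra).
assert (Hth2 : 0 < 1 - theta) by (rewrite Hth1; apply Rdiv_lt_0_compat; lra).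
(* the width of the wells: it must leave room for a frame, for both shares of
   the time, and for the tolerance *)
set (h := Rmin (Rmin (1 / 16) (eta / (2 * D))) (Rmin (theta / 4) ((1 - theta) / 4))).
assert (Hh1 : h <= 1 / 16) by (apply Rle_trans with (1 := Rmin_l _ _), Rmin_l).
assert (Hh2 : h <= eta / (2 * D)) by (apply Rle_trans with (1 := Rmin_l _ _), Rmin_r).
assert (Hh3 : h <= theta / 4) by (apply Rle_trans with (1 := Rmin_r _ _), Rmin_l).
assert (Hh4 : h <= (1 - theta) / 4) by (apply Rle_trans with (1 := Rmin_r _ _), Rmin_r).
assert (Hh : 0 < h).
{ repeat apply Rmin_glb_lt; try lra. apply Rdiv_lt_0_compat; lra. }
destruct (frame_exists L F g a b h H ltac:(lra)) as [kap [del [p [c [q Fr]]]]].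
set (C := Rmax (barrier_time kap (- c) (- p)) (barrier_time kap c q)).
assert (HC1 : barrier_time kap (- c) (- p) <= C) by apply Rmax_l.
assert (HC2 : barrier_time kap c q <= C) by apply Rmax_r.
assert (HC : 0 <= C).
{ apply Rle_trans with (2 := HC2). unfold barrier_time.
  assert (0 <= sqrt ((q - c) / kap)) by apply sqrt_pos. lra. }
(* so that the barrier times are at most [h * K] *)
exists ((C + 1) / h). split. { apply Rdiv_lt_0_compat; lra. }
intros K HK.
assert (HhK : C + 1 <= h * K).
{ apply (Rmult_le_compat_l h) in HK; [|lra].
  replace (h * ((C + 1) / h)) with (C + 1) in HK by (field; lra). exact HK. }
assert (HKpos : 0 < K) by (apply Rmult_lt_reg_l with h; lra).
assert (P1 : 4 * (h * K) <= theta * K) by nra.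
assert (P2 : 4 * (h * K) <= (1 - theta) * K) by nra.
destruct (balanced_shot L F g a b h kap del p c q K theta C Fr) as
  [s [t [u [u1 [T1 [T2 [Hs [Ht [S [B1 B2]]]]]]]]]]; auto; try lra.
assert (B := shot_lag_bounds Fr ltac:(lra) Hs Ht S).
assert (Herr : forall x, x <= C + h * K -> D * x <= eta * K).
{ intros x Hx. apply Rle_trans with (D * (2 * (h * K))); [apply Rmult_le_compat_l; lra|].
  apply (Rmult_le_compat_r (2 * D)) in Hh2; [|lra].
  replace (eta / (2 * D) * (2 * D)) with eta in Hh2 by (field; lra). nra. }
exists (slope p q s t), (fun y => u (- T1 + y)), (fun y => u1 (- T1 + y)).
apply (half_period_of_shot L F g a b h kap del p c q K s t rs eta u u1 T1 T2); auto.
- rewrite B1, Hth1. reflexivity.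
- apply Herr. lra.
- apply Herr. lra.
Qed.

(** * The reduced potential as a double well *)

(** The first two derivatives of [Psim Psi m] on the positive half-line. *)
Definition Psim1 (Psi : R -> R) (m r : R) : R := Derive Psi r + m ^ 2 / (2 * r ^ 2).

Definition Psim2 (Psi : R -> R) (m r : R) : R := Derive_n Psi 2 r - m ^ 2 / r ^ 3.

Lemma Ck2_derive (Psi : R -> R) (r : R) :
  Ck_on 2 (fun r => 0 < r) Psi -> 0 < r ->
  is_derive Psi r (Derive Psi r) /\ is_derive (Derive Psi) r (Derive_n Psi 2 r).
Proof.
intros [H _] Hr. split.
- apply Derive_correct. exact (H 1%nat r ltac:(lia) Hr).
- apply (Derive_correct (Derive Psi)). exact (H 2%nat r ltac:(lia) Hr).
Qed.

Lemma is_derive_Psim (Psi : R -> R) (m r : R) :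
  Ck_on 2 (fun r => 0 < r) Psi -> 0 < r ->
  is_derive (Psim Psi m) r (Psim1 Psi m r).
Proof.
intros H Hr. destruct (Ck2_derive Psi r H Hr) as [H1 _].
unfold Psim, Psim1. auto_derive.
- repeat split; [eexists; eassumption|lra].
- change (Derive (fun x => Psi x) r) with (Derive Psi r). field. lra.
Qed.

Lemma is_derive_Psim1 (Psi : R -> R) (m r : R) :
  Ck_on 2 (fun r => 0 < r) Psi -> 0 < r ->
  is_derive (Psim1 Psi m) r (Psim2 Psi m r).
Proof.
intros H Hr. destruct (Ck2_derive Psi r H Hr) as [_ H2].
assert (E : is_derive (fun r => m ^ 2 / (2 * r ^ 2)) r (- (m ^ 2 / r ^ 3))).
{ auto_derive.
  - assert (0 < r * (r * 1)) by nra. repeat split; nra.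
  - field. lra. }
evar_last. { apply (is_derive_plus (V := R_NormedModule) (Derive Psi) _ r _ _ H2 E). }
change plus with Rplus. unfold Psim2. simpl. ring.
Qed.

Lemma continuous_Psim2 (Psi : R -> R) (m r : R) :
  Ck_on 2 (fun r => 0 < r) Psi -> 0 < r -> continuous (Psim2 Psi m) r.
Proof.
intros [_ H] Hr. apply (continuous_minus (V := R_NormedModule)); [now apply H|].
apply (ex_derive_continuous (V := R_NormedModule)). auto_derive.
assert (0 < r * (r * 1)) by nra. repeat split; nra.
Qed.

(** Projection onto [[a, b]]. *)
Definition clamp (a b r : R) : R := Rmax a (Rmin r b).

Lemma clamp_range (a b r : R) : a <= b -> a <= clamp a b r <= b.
Proof. intros H. unfold clamp, Rmax, Rmin. repeat destruct Rle_dec; lra. Qed.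

Lemma clamp_id (a b r : R) : a <= r <= b -> clamp a b r = r.
Proof. intros H. unfold clamp. rewrite Rmin_left, Rmax_right; lra. Qed.

Lemma clamp_lipschitz (a b x y : R) : Rabs (clamp a b x - clamp a b y) <= Rabs (x - y).
Proof.
unfold clamp, Rmax, Rmin. repeat destruct Rle_dec; unfold Rabs; repeat destruct Rcase_abs; lra.
Qed.

(** Clamping makes the force globally Lipschitz; the force vanishes outside
    [(a, b)] because the slope of [Psim] at both ends is that of the line. *)
Lemma bitangent_double_well (Psi : R -> R) (m a b : R) :
  Ck_on 2 (fun r => 0 < r) Psi -> 0 < a < b -> strict_bitangent (Psim Psi m) a b ->
  exists L F beta, double_well L F (fun r => Psim1 Psi m (clamp a b r) - beta) a b.
Proof.
intros HPsi Hab [alpha [beta [Ea [Da [Eb [Db [d [Hd Habove]]]]]]]].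
assert (Ba : Psim1 Psi m a = beta).
{ rewrite <- (is_derive_unique _ _ _ Da). symmetry. apply is_derive_unique. apply is_derive_Psim; auto; lra. }
assert (Bb : Psim1 Psi m b = beta).
{ rewrite <- (is_derive_unique _ _ _ Db). symmetry. apply is_derive_unique. apply is_derive_Psim; auto; lra. }
set (g := fun r => Psim1 Psi m (clamp a b r) - beta).
destruct (bounded_continuity (K := R_AbsRing) (V := R_NormedModule) (Psim2 Psi m) a b) as [M HM].
{ intros x Hx. apply continuous_Psim2; auto; lra. }
assert (HM0 : 0 <= M).
{ apply Rle_trans with (2 := Rlt_le _ _ (HM a ltac:(lra))). apply Rabs_pos. }
assert (Hlip : lipschitz M g).
{ intros x y. unfold g.
  assert (Hx := clamp_range a b x ltac:(lra)). assert (Hy := clamp_range a b y ltac:(lra)).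
  destruct (MVT_gen (Psim1 Psi m) (clamp a b y) (clamp a b x) (Psim2 Psi m)) as [z [Hz E]].
  - intros z Hz. apply is_derive_Psim1; auto.
    assert (a <= Rmin (clamp a b y) (clamp a b x)) by (apply Rmin_glb; lra). lra.
  - intros z Hz. apply (is_derive_continuity_pt _ _ (Psim2 Psi m z)). apply is_derive_Psim1; auto.
    assert (a <= Rmin (clamp a b y) (clamp a b x)) by (apply Rmin_glb; lra). lra.
  - replace (Psim1 Psi m (clamp a b x) - beta - (Psim1 Psi m (clamp a b y) - beta)) with
      (Psim1 Psi m (clamp a b x) - Psim1 Psi m (clamp a b y)) by ring.
    rewrite E, Rabs_mult. apply Rmult_le_compat; try apply Rabs_pos; [|apply clamp_lipschitz].
    apply Rlt_le, HM.
    assert (a <= Rmin (clamp a b y) (clamp a b x)) by (apply Rmin_glb; lra).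
    assert (Rmax (clamp a b y) (clamp a b x) <= b) by (apply Rmax_lub; lra). lra. }
assert (Cg := lipschitz_continuous M g Hlip).
set (F := fun r => RInt g a r).
assert (HF : forall r, a <= r <= b -> F r = Psim Psi m r - (alpha + beta * r)).
{ intros r Hr. unfold F. apply is_RInt_unique.
  replace (Psim Psi m r - (alpha + beta * r)) with
    (minus (Psim Psi m r - (alpha + beta * r)) (Psim Psi m a - (alpha + beta * a)))
    by (rewrite Ea; unfold minus, plus, opp; simpl; ring).
  apply (is_RInt_derive (V := R_CompleteNormedModule) (fun r => Psim Psi m r - (alpha + beta * r))).
  - intros x Hx. rewrite Rmin_left, Rmax_right in Hx by lra. evar_last.
    + apply (is_derive_minus (V := R_NormedModule) (Psim Psi m) (fun r => alpha + beta * r)).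
      * apply is_derive_Psim; auto; lra.
      * auto_derive; [auto|reflexivity].
    + unfold g. rewrite clamp_id by lra. unfold minus, plus, opp; simpl. ring.
  - intros x _. apply Cg. }
exists M, F, beta. fold g. split; auto.
- lra.
- intros r. now apply is_derive_prim.
- intros r Hr. unfold F. rewrite (RInt_congr g (fun _ => 0)).
  + rewrite RInt_cst. ring.
  + intros x Hx. rewrite Rmin_right, Rmax_left in Hx by lra. unfold g, clamp.
    rewrite Rmin_left, Rmax_left, Ba by lra. ring.
- intros r Hr. unfold F. rewrite <- (RInt_split g a b r) by now apply ex_RInt_cont.
  assert (E := HF b ltac:(lra)). unfold F in E. rewrite E, Eb.
  rewrite (RInt_congr g (fun _ => 0)).
  + rewrite RInt_cst. ring.
  + intros x Hx. rewrite Rmin_left, Rmax_right in Hx by lra. unfold g, clamp.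
    rewrite Rmin_right, Rmax_right, Bb by lra. ring.
- intros r Hr. rewrite HF by lra. assert (h := Habove r ltac:(lra) ltac:(lra) ltac:(lra)). lra.
Qed.

(** * From half a period to a periodic solution *)

Lemma half_period_even {L : R} {F g : R -> R} {a b rs K eta lam : R} {w w1 : R -> R} :
  double_well L F g a b -> half_period F g a b rs K eta lam w w1 ->
  (forall y, w (- y) = w y) /\ (forall y, w (2 * K - y) = w y).
Proof.
intros H P. set (f := fun r => g r - lam).
assert (Hf : lipschitz L f) by apply lipschitz_minus_const, (dw_lip H).
assert (Ht := hp_traj P). fold f in Ht.
(* the trajectory is symmetric about each of its turning points *)
assert (Hsym : forall T, w1 T = 0 -> forall y, w (T - y) = w (T + y)).
{ intros T HT.
  assert (U := trajectory_unique L f _ _ _ _ (dw_L H) Hf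
    (trajectory_reverse f w w1 T Ht) (trajectory_shift f w w1 T Ht)).
  intros y. apply U.
  - f_equal. ring.
  - rewrite Rminus_0_r, Rplus_0_r, HT. ring. }
split; intros y.
- assert (E := Hsym 0 (hp_min P) y).
  now rewrite Rminus_0_l, Rplus_0_l in E.
- assert (E := Hsym K (hp_max P) (y - K)).
  replace (K - (y - K)) with (2 * K - y) in E by ring.
  now replace (K + (y - K)) with y in E by ring.
Qed.

Lemma half_period_periodic (w : R -> R) (K : R) :
  (forall y, w (- y) = w y) -> (forall y, w (2 * K - y) = w y) ->
  forall y, w (y + 2 * K) = w y.
Proof.
intros H1 H2 y. rewrite <- (H1 y), <- (H2 (- y)). f_equal. ring.
Qed.

(** Every value of an even function of period [2 * K] is taken on [[0, K]]. *)
Lemma half_period_fold (w : R -> R) (K : R) :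
  0 < K -> (forall y, w (- y) = w y) -> (forall y, w (2 * K - y) = w y) ->
  forall y, exists z, 0 <= z <= K /\ w y = w z.
Proof.
intros HK H1 H2 y.
assert (Hp := half_period_periodic w K H1 H2).
assert (Hn : forall n z, w (z + INR n * (2 * K)) = w z).
{ induction n as [|n IH]; intros z; [simpl; f_equal; ring|].
  rewrite S_INR. replace (z + (INR n + 1) * (2 * K)) with ((z + INR n * (2 * K)) + 2 * K) by ring.
  now rewrite Hp. }
destruct (nfloor_ex (Rabs y / (2 * K))) as [n Hn2].
{ apply Rdiv_le_0_compat; [apply Rabs_pos|lra]. }
set (z := Rabs y - INR n * (2 * K)).
assert (Ez : w y = w z).
{ transitivity (w (Rabs y)).
  - unfold Rabs. destruct Rcase_abs; auto.
  - rewrite <- (Hn n z). f_equal. unfold z. ring. }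
assert (Hz : 0 <= z < 2 * K).
{ assert (E : Rabs y = Rabs y / (2 * K) * (2 * K)) by (field; lra).
  unfold z. rewrite E. split; nra. }
destruct (Rle_or_lt z K) as [h|h].
- exists z. split; [lra|exact Ez].
- exists (2 * K - z). split; [lra|]. now rewrite H2.
Qed.

Lemma half_period_range {L : R} {F g : R -> R} {a b rs K eta lam : R} {w w1 : R -> R} :
  double_well L F g a b -> half_period F g a b rs K eta lam w w1 -> 0 < K ->
  forall y, a <= w y <= b.
Proof.
intros H P HK y. destruct (half_period_even H P) as [H1 H2].
destruct (half_period_fold w K HK H1 H2 y) as [z [Hz ->]].
now apply (hp_range P).
Qed.

Lemma half_period_mean {L : R} {F g : R -> R} {a b rs K eta lam : R} {w w1 : R -> R} (k omega : R) :
  double_well L F g a b -> half_period F g a b rs K eta lam w w1 ->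
  0 < k -> 0 < K -> k * omega = 2 * K ->
  RInt (fun x => w (k * x)) 0 omega = rs * omega.
Proof.
intros H P Hk HK HkK. destruct (half_period_even H P) as [_ Hev].
assert (Cw : forall y, continuous w y)
  by (intros y; apply (is_derive_continuous _ _ _ (traj_u (hp_traj P) y))).
rewrite (RInt_congr _ (fun x => w (k * x + 0))) by (intros; f_equal; ring).
rewrite RInt_affine; [|now apply ex_RInt_cont|lra].
replace (k * 0 + 0) with 0 by ring. replace (k * omega + 0) with (2 * K) by lra.
rewrite <- (RInt_split w 0 K (2 * K)) by now apply ex_RInt_cont.
assert (E := RInt_symmetric w (2 * K) 0 K (ex_RInt_cont _ _ _ Cw) Hev).
replace (2 * K - K) with K in E by ring. rewrite Rminus_0_r in E. rewrite E.
rewrite (hp_mean P).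
replace (rs * K + rs * K) with (rs * (k * omega)) by (rewrite HkK; ring). fieldR. lra.
Qed.

Lemma Ck3_intro (f f1 f2 f3 : R -> R) :
  (forall x, is_derive f x (f1 x)) -> (forall x, is_derive f1 x (f2 x)) ->
  (forall x, is_derive f2 x (f3 x)) -> (forall x, continuous f3 x) ->
  Ck_on 3 (fun _ => True) f /\ Derive_n f 2 = f2.
Proof.
intros H1 H2 H3 H4.
assert (E1 : Derive_n f 1 = f1) by (apply functional_extensionality; intros x; apply is_derive_unique, H1).
assert (E2 : Derive_n f 2 = f2).
{ change (Derive_n f 2) with (Derive (Derive_n f 1)). rewrite E1.
  apply functional_extensionality; intros x; apply is_derive_unique, H2. }
assert (E3 : Derive_n f 3 = f3).
{ change (Derive_n f 3) with (Derive (Derive_n f 2)). rewrite E2.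
  apply functional_extensionality; intros x; apply is_derive_unique, H3. }
split; [split|exact E2].
- intros j x Hj _. destruct j as [|[|[|[|j]]]]; try lia; [exact I| | |].
  + exists (f1 x). apply H1.
  + change (ex_derive (Derive_n f 1) x). rewrite E1. exists (f2 x). apply H2.
  + change (ex_derive (Derive_n f 2) x). rewrite E2. exists (f3 x). apply H3.
- intros x _. rewrite E3. apply H4.
Qed.

(** The equation amounts to [eps * rho'' = Psim1(rho) - const], because
    [(m^2 / rho + p(rho))' = rho * (Psim1(rho))']. *)
Lemma steady_solution_intro (Psi mu : R -> R) (eps m cst : R) (rho r1 r2 r3 : R -> R) :
  Ck_on 2 (fun r => 0 < r) Psi ->
  (m = 0 \/ forall r, mu r = 0) ->
  (forall x, 0 < rho x) ->
  (forall x, is_derive rho x (r1 x)) -> (forall x, is_derive r1 x (r2 x)) ->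
  (forall x, is_derive r2 x (r3 x)) -> (forall x, continuous r3 x) ->
  (forall x, eps * r2 x = Psim1 Psi m (rho x) - cst) ->
  steady_solution Psi mu eps m rho.
Proof.
intros HPsi Hmu Hpos H1 H2 H3 H4 Heq.
destruct (Ck3_intro rho r1 r2 r3 H1 H2 H3 H4) as [HC E2].
(* the viscous flux vanishes with the viscosity, or with the velocity *)
assert (Hvisc : (fun y => mu (rho y) * Derive (velocity m rho) y) = (fun _ => 0)).
{ apply functional_extensionality; intros y. destruct Hmu as [-> | Hmu].
  - rewrite (Derive_ext (velocity 0 rho) (fun _ => 0)).
    + rewrite Derive_const. ring.
    + intros t. unfold velocity, Rdiv. ring.
  - rewrite Hmu. ring. }
split; [exact HC|split; [exact Hpos|split]].
- intros x. apply (ex_derive_ext (fun _ => 0)); [|apply ex_derive_const].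
  intros t. symmetry. exact (equal_f Hvisc t).
- intros x. rewrite Hvisc, Derive_const, E2.
  destruct (Ck2_derive Psi (rho x) HPsi (Hpos x)) as [P1 P2].
  assert (Hx := Hpos x).
  assert (D1 : Derive (fun y => m ^ 2 / rho y) x = - (m ^ 2 / rho x ^ 2 * r1 x)).
  { apply is_derive_unique. auto_derive.
    - split; [exists (r1 x); apply H1|]. split; [lra|exact I].
    - rewrite (is_derive_unique (fun x0 : R => rho x0) _ _ (H1 x)). field. lra. }
  assert (D2 : Derive (fun y => pressure Psi (rho y)) x = rho x * Derive_n Psi 2 (rho x) * r1 x).
  { apply is_derive_unique.
    assert (Hp : is_derive (pressure Psi) (rho x) (rho x * Derive_n Psi 2 (rho x))).
    { evar_last.
      - apply (is_derive_minus (V := R_NormedModule) (fun r => r * Derive Psi r) Psi); [|apply P1].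
        apply (is_derive_mult (K := R_AbsRing) (fun r : R => r) (Derive Psi)); [apply is_derive_id|apply P2|].
        intros; apply Rmult_comm.
      - unfold minus, plus, opp, mult, one; simpl. ring. }
    evar_last.
    - apply (is_derive_comp (K := R_AbsRing) (V := R_NormedModule) (pressure Psi) rho); [exact Hp|apply H1].
    - unfold scal; simpl; unfold mult; simpl. ring. }
  assert (D3 : Derive (fun y => eps * r2 y) x = Psim2 Psi m (rho x) * r1 x).
  { apply is_derive_unique. apply (is_derive_ext (fun y => Psim1 Psi m (rho y) - cst)).
    - intros t. symmetry. apply Heq.
    - evar_last.
      + apply (is_derive_minus (V := R_NormedModule) (fun y => Psim1 Psi m (rho y)) (fun _ => cst));
          [|apply (is_derive_const (V := R_NormedModule))].
        apply (is_derive_comp (K := R_AbsRing) (V := R_NormedModule) (Psim1 Psi m) rho); [|apply H1].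
        apply is_derive_Psim1; auto.
      + unfold minus, plus, opp, scal, zero; simpl; unfold mult; simpl. ring. }
  rewrite D1, D2, D3. unfold Psim2. field. lra.
Qed.

Lemma half_period_profile (Psi mu : R -> R) (L : R) (F : R -> R)
  (beta a b m rs eps omega K eta lam : R) (w w1 : R -> R) :
  Ck_on 2 (fun r => 0 < r) Psi -> 0 < a -> 
  double_well L F (fun r => Psim1 Psi m (clamp a b r) - beta) a b ->
  half_period F (fun r => Psim1 Psi m (clamp a b r) - beta) a b rs K eta lam w w1 ->
  0 < eps -> 0 < omega -> K = omega / (2 * sqrt eps) ->
  (m = 0 \/ forall r, mu r = 0) ->
  periodic_profile Psi mu eps m omega rs a b (fun x => w (/ sqrt eps * x)).
Proof.
intros HPsi Ha H P Heps Hom HK Hmu.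
assert (Hse : 0 < sqrt eps) by now apply sqrt_lt_R0.
assert (Hse2 : sqrt eps * sqrt eps = eps) by (apply sqrt_sqrt; lra).
set (k := / sqrt eps).
assert (Hk : 0 < k) by now apply Rinv_0_lt_compat.
assert (Hk2 : eps * (k * k) = 1).
{ rewrite <- Hse2. unfold k. field. lra. }
assert (HkK : k * omega = 2 * K) by (rewrite HK; unfold k; field; lra).
assert (HK0 : 0 < K) by nra.
destruct (half_period_even H P) as [Hev1 Hev2].
assert (Hrange : forall y, a <= w y <= b).
{ exact (half_period_range H P HK0). }
assert (Ht := hp_traj P).
set (g := fun r => Psim1 Psi m (clamp a b r) - beta) in *.
assert (Hg : forall y, g (w y) = Psim1 Psi m (w y) - beta) by (intros y; unfold g; now rewrite clamp_id).
assert (Cw : forall y, continuous w y) by (intros y; apply (is_derive_continuous _ _ _ (traj_u Ht y))).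
assert (Cw1 : forall y, continuous w1 y) by (intros y; apply (is_derive_continuous _ _ _ (traj_u1 Ht y))).
assert (Hlin : forall x, is_derive (fun x : R => k * x) x k) by (intros x; auto_derive; auto; ring).
assert (Clin : forall h : R -> R, (forall y, continuous h y) -> forall x, continuous (fun x => h (k * x)) x).
{ intros h Ch x. apply (continuous_comp (fun x => k * x) h); auto.
  apply (is_derive_continuous _ _ _ (Hlin x)). }
split; [|split; [|split; [|split]]].
- apply (steady_solution_intro Psi mu eps m (beta + lam) _ (fun x => k * w1 (k * x))
    (fun x => k * k * (Psim1 Psi m (w (k * x)) - beta - lam))
    (fun x => k * k * (Psim2 Psi m (w (k * x)) * (k * w1 (k * x))))); auto.
  + intros x. assert (h := Hrange (k * x)). lra.
  + intros x. apply (is_derive_comp (K := R_AbsRing) (V := R_NormedModule) w (fun x => k * x)); auto.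
    apply (traj_u Ht).
  + intros x. evar_last.
    * apply (is_derive_scal (fun x => w1 (k * x)) x k).
      apply (is_derive_comp (K := R_AbsRing) (V := R_NormedModule) w1 (fun x => k * x)); auto.
      apply (traj_u1 Ht).
    * unfold scal; simpl; unfold mult; simpl. rewrite Hg. ring.
  + intros x. evar_last.
    * apply (is_derive_scal (fun x => Psim1 Psi m (w (k * x)) - beta - lam) x (k * k)).
      apply (is_derive_minus (V := R_NormedModule) (fun x => Psim1 Psi m (w (k * x)) - beta) (fun _ => lam));
        [|apply (is_derive_const (V := R_NormedModule))].
      apply (is_derive_minus (V := R_NormedModule) (fun x => Psim1 Psi m (w (k * x))) (fun _ => beta));
        [|apply (is_derive_const (V := R_NormedModule))].
      apply (is_derive_comp (K := R_AbsRing) (V := R_NormedModule) (Psim1 Psi m) (fun x => w (k * x))).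
      { apply is_derive_Psim1; auto. assert (h := Hrange (k * x)). lra. }
      apply (is_derive_comp (K := R_AbsRing) (V := R_NormedModule) w (fun x => k * x)); auto.
      apply (traj_u Ht).
    * unfold minus, plus, opp, scal, zero; simpl; unfold mult; simpl. ring.
  + intros x. apply (continuous_mult (K := R_AbsRing) (fun _ => k * k)); [apply continuous_const|].
    apply (continuous_mult (K := R_AbsRing) (fun x => Psim2 Psi m (w (k * x))) (fun x => k * w1 (k * x))).
    * apply (continuous_comp (fun x => w (k * x)) (Psim2 Psi m)); auto.
      apply continuous_Psim2; auto. assert (h := Hrange (k * x)). lra.
    * apply (continuous_mult (K := R_AbsRing) (fun _ => k)); auto. apply continuous_const.
  + intros x. replace (eps * (k * k * (Psim1 Psi m (w (k * x)) - beta - lam))) with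
      (eps * (k * k) * (Psim1 Psi m (w (k * x)) - beta - lam)) by ring.
    rewrite Hk2. ring.
- intros x. rewrite Rmult_plus_distr_l, HkK.
  now apply half_period_periodic.
- intros [c Hc]. assert (h := hp_osc P).
  assert (h0 := Hc 0). assert (h1 := Hc (K / k)).
  rewrite Rmult_0_r in h0. replace (k * (K / k)) with K in h1 by (field; lra). lra.
- rewrite (half_period_mean k omega H P Hk HK0 HkK). field. lra.
- intros x. apply Hrange.
Qed.

(** * The sharp-interface limit *)

(** The periodic two-phase function equal to [a] on an interval of length
    [th * omega] centred at the period points and to [b] elsewhere. *)
Definition two_phase (omega th a b x : R) : R :=
  if Rle_dec (cos (2 * PI * x / omega)) (cos (PI * th)) then b else a.

Lemma two_phase_values (omega th a b x : R) :
  two_phase omega th a b x = a \/ two_phase omega th a b x = b.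
Proof. unfold two_phase. destruct Rle_dec; auto. Qed.

Lemma two_phase_periodic (omega th a b : R) :
  0 < omega -> periodic omega (two_phase omega th a b).
Proof.
intros Hom x. unfold two_phase.
replace (2 * PI * (x + omega) / omega) with (2 * PI * x / omega + 2 * INR 1 * PI) by (simpl; field; lra).
now rewrite cos_period.
Qed.

Lemma angle_scale (omega x y : R) : 0 < omega -> x <= y -> 2 * PI * x / omega <= 2 * PI * y / omega.
Proof.
intros Hom Hxy. assert (HPI := PI_RGT_0). unfold Rdiv.
apply Rmult_le_compat_r; [apply Rlt_le, Rinv_0_lt_compat; lra|]. nra.
Qed.

Lemma two_phase_low (omega th a b x : R) :
  0 < omega -> 0 < th < 1 -> - (th * omega / 2) < x < th * omega / 2 ->
  two_phase omega th a b x = a.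
Proof.
intros Hom Hth Hx. assert (HPI := PI_RGT_0). unfold two_phase.
destruct Rle_dec as [Hle|]; auto. exfalso.
assert (Hpos : forall y, 0 <= y < th * omega / 2 -> cos (PI * th) < cos (2 * PI * y / omega)).
{ intros y Hy.
  assert (E : PI * th = 2 * PI * (th * omega / 2) / omega) by (field; lra).
  assert (H0 : 0 <= 2 * PI * y / omega) by (apply Rdiv_le_0_compat; nra).
  assert (H1 : 2 * PI * y / omega < PI * th).
  { rewrite E. unfold Rdiv at 1 3. apply Rmult_lt_compat_r; [apply Rinv_0_lt_compat; lra|]. nra. }
  apply cos_decreasing_1; nra. }
destruct (Rle_or_lt 0 x) as [h|h].
- assert (h2 := Hpos x ltac:(lra)). lra.
- assert (h2 := Hpos (- x) ltac:(lra)).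
  replace (2 * PI * - x / omega) with (- (2 * PI * x / omega)) in h2 by (field; lra).
  rewrite cos_neg in h2. lra.
Qed.

Lemma two_phase_high (omega th a b x : R) :
  0 < omega -> 0 < th < 1 -> th * omega / 2 <= x <= omega - th * omega / 2 ->
  two_phase omega th a b x = b.
Proof.
intros Hom Hth Hx. assert (HPI := PI_RGT_0). unfold two_phase.
destruct Rle_dec as [|Hle]; auto. exfalso. apply Hle.
assert (Hpos : forall y, th * omega / 2 <= y <= omega / 2 -> cos (2 * PI * y / omega) <= cos (PI * th)).
{ intros y Hy.
  replace (PI * th) with (2 * PI * (th * omega / 2) / omega) by (field; lra).
  assert (0 <= th * omega / 2) by nra.
  assert (E : 2 * PI * (omega / 2) / omega = PI) by (field; lra).
  assert (h1 := angle_scale omega _ _ Hom (proj1 Hy)).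
  assert (h2 := angle_scale omega _ _ Hom (proj2 Hy)). rewrite E in h2.
  assert (h3 : 0 <= 2 * PI * (th * omega / 2) / omega) by (apply Rdiv_le_0_compat; nra).
  apply cos_decr_1; lra. }
destruct (Rle_or_lt x (omega / 2)) as [h|h].
- apply Hpos. lra.
- assert (h2 := Hpos (omega - x) ltac:(lra)).
  replace (2 * PI * (omega - x) / omega) with (- (2 * PI * x / omega) + 2 * INR 1 * PI) in h2
    by (simpl; field; lra).
  now rewrite cos_period, cos_neg in h2.
Qed.

Lemma lim_left_of_constant (f : R -> R) (x l d : R) :
  0 < d -> (forall y, x - d < y < x -> f y = l) -> filterlim f (at_left x) (locally l).
Proof.
intros Hd Hf. apply (filterlim_ext_loc (fun _ => l)); [|apply filterlim_const].
exists (mkposreal d Hd). intros y Hy Hyx. symmetry. apply Hf.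
apply Rabs_lt_between in Hy. unfold minus, plus, opp in Hy; simpl in Hy. lra.
Qed.

Lemma lim_right_of_constant (f : R -> R) (x l d : R) :
  0 < d -> (forall y, x < y < x + d -> f y = l) -> filterlim f (at_right x) (locally l).
Proof.
intros Hd Hf. apply (filterlim_ext_loc (fun _ => l)); [|apply filterlim_const].
exists (mkposreal d Hd). intros y Hy Hyx. symmetry. apply Hf.
apply Rabs_lt_between in Hy. unfold minus, plus, opp in Hy; simpl in Hy. lra.
Qed.

Lemma continuous_of_constant (f : R -> R) (x l d : R) :
  0 < d -> (forall y, x - d < y < x + d -> f y = l) -> continuous f x.
Proof.
intros Hd Hf. unfold continuous. rewrite (Hf x) by lra.
apply (filterlim_ext_loc (fun _ => l)); [|apply filterlim_const].
exists (mkposreal d Hd). intros y Hy. symmetry. apply Hf.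
apply Rabs_lt_between in Hy. unfold minus, plus, opp in Hy; simpl in Hy. lra.
Qed.

Lemma two_phase_two_jumps (omega th a b : R) :
  0 < omega -> 0 < th < 1 -> a < b -> exactly_two_jumps omega (two_phase omega th a b).
Proof.
intros Hom Hth Hab.
assert (Hper := two_phase_periodic omega th a b Hom).
set (j := th * omega / 2). assert (Hj : 0 < j < omega / 2) by (unfold j; split; nra).
assert (Hlow : forall x, - j < x < j -> two_phase omega th a b x = a)
  by (intros; now apply two_phase_low).
assert (Hhigh : forall x, j <= x <= omega - j -> two_phase omega th a b x = b)
  by (intros; now apply two_phase_high).
assert (Hlow2 : forall x, omega - j < x < omega + j -> two_phase omega th a b x = a).
{ intros x Hx. replace x with (x - omega + omega) by ring. rewrite Hper. apply Hlow. lra. }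
split; auto. exists j, (omega - j). repeat split; try lra.
- exists a, b. split; [lra|split].
  + apply (lim_left_of_constant _ _ _ j); [lra|]. intros y Hy. apply Hlow. lra.
  + apply (lim_right_of_constant _ _ _ (omega - 2 * j)); [lra|]. intros y Hy. apply Hhigh. lra.
- exists b, a. split; [lra|split].
  + apply (lim_left_of_constant _ _ _ (omega - 2 * j)); [lra|]. intros y Hy. apply Hhigh. lra.
  + apply (lim_right_of_constant _ _ _ j); [lra|]. intros y Hy. apply Hlow2. lra.
- intros x Hx Hxa Hxb.
  destruct (Rlt_or_le x j) as [h1|h1].
  { apply (continuous_of_constant _ _ a (j - x)); [lra|]. intros y Hy.
    destruct (Rlt_or_le (- j) y) as [h|h]; [apply Hlow; lra|]. exfalso. lra. }
  destruct (Rlt_or_le x (omega - j)) as [h2|h2].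
  { apply (continuous_of_constant _ _ b (Rmin (x - j) (omega - j - x))); [apply Rmin_glb_lt; lra|].
    assert (m1 := Rmin_l (x - j) (omega - j - x)). assert (m2 := Rmin_r (x - j) (omega - j - x)).
    intros y Hy. apply Hhigh. lra. }
  apply (continuous_of_constant _ _ a (x - (omega - j))); [lra|]. intros y Hy. apply Hlow2. lra.
Qed.

(** The conserved mean makes the excess over [a] near the minimum equal to the
    deficit below [b] near the maximum, so [hp_near] controls the whole error. *)
Lemma half_period_L1 (L : R) (F g : R -> R) (a b rs eps omega K eta lam : R) (w w1 : R -> R) :
  double_well L F g a b -> a < rs < b ->
  half_period F g a b rs K eta lam w w1 ->
  0 < eps -> 0 < omega -> K = omega / (2 * sqrt eps) ->
  let err := fun x => Rabs (w (/ sqrt eps * x) - two_phase omega ((b - rs) / (b - a)) a b x) in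
  ex_RInt err 0 omega /\ 0 <= RInt err 0 omega <= 2 * eta * omega.
Proof.
intros H Hrs P Heps Hom HK err.
assert (Hse : 0 < sqrt eps) by now apply sqrt_lt_R0.
set (k := / sqrt eps) in *.
assert (Hk : 0 < k) by now apply Rinv_0_lt_compat.
assert (HkK : k * omega = 2 * K) by (rewrite HK; unfold k; field; lra).
assert (HK0 : 0 < K) by nra.
destruct (half_period_even H P) as [Hev1 Hev2].
assert (Hrange : forall y, a <= w y <= b).
{ exact (half_period_range H P HK0). }
assert (Cw : forall y, continuous w y)
  by (intros y; apply (is_derive_continuous _ _ _ (traj_u (hp_traj P) y))).
set (D := b - a) in *. assert (HD : 0 < D) by (unfold D; lra).
set (th := (b - rs) / D) in *.
assert (HthD : th * D = b - rs) by (unfold th; field; lra).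
assert (Hth : 0 < th < 1) by (split; unfold D in *; nra).
set (j := th * omega / 2). assert (Hj : 0 < j < omega / 2) by (unfold j; split; nra).
set (rho := fun x => w (k * x)).
assert (Crho : forall x, continuous rho x).
{ intros x. unfold rho. apply (continuous_comp (fun x => k * x) w); auto.
  apply (ex_derive_continuous (V := R_NormedModule)). auto_derive. auto. }
assert (Hsym : forall x, rho (omega - x) = rho x).
{ intros x. unfold rho. rewrite <- (Hev2 (k * x)). f_equal. rewrite <- HkK. ring. }
assert (Eerr : forall x, err x = Rabs (rho x - two_phase omega th a b x)) by reflexivity.
clearbody err.
set (A := RInt (fun x => rho x - a) 0 j).
assert (CA : forall x, continuous (fun x => rho x - a) x).
{ intros x. apply (continuous_minus (V := R_NormedModule)); auto. apply continuous_const. }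
assert (CB : forall x, continuous (fun x => b - rho x) x).
{ intros x. apply (continuous_minus (V := R_NormedModule)); auto. apply continuous_const. }
assert (I1 : is_RInt err 0 j A).
{ apply (is_RInt_ext (fun x => rho x - a)).
  - intros x Hx. rewrite Rmin_left, Rmax_right in Hx by lra. rewrite Eerr.
    rewrite two_phase_low by (fold j; lra). symmetry. apply Rabs_pos_eq.
    assert (h := Hrange (k * x)). unfold rho. lra.
  - apply (RInt_correct (V := R_CompleteNormedModule)). now apply ex_RInt_cont. }
assert (I2 : is_RInt err j (omega - j) (RInt (fun x => b - rho x) j (omega - j))).
{ apply (is_RInt_ext (fun x => b - rho x)).
  - intros x Hx. rewrite Rmin_left, Rmax_right in Hx by lra. rewrite Eerr.
    rewrite two_phase_high by (fold j; lra). rewrite Rabs_minus_sym. symmetry. apply Rabs_pos_eq.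
    assert (h := Hrange (k * x)). unfold rho. lra.
  - apply (RInt_correct (V := R_CompleteNormedModule)). now apply ex_RInt_cont. }
assert (EA : RInt (fun x => rho x - a) (omega - j) omega = A).
{ assert (E := RInt_symmetric (fun x => rho x - a) omega 0 j (ex_RInt_cont _ _ _ CA)
    ltac:(intros x; simpl; now rewrite Hsym)).
  rewrite Rminus_0_r in E. exact E. }
assert (I3 : is_RInt err (omega - j) omega A).
{ rewrite <- EA. apply (is_RInt_ext (fun x => rho x - a)).
  - intros x Hx. rewrite Rmin_left, Rmax_right in Hx by lra. rewrite Eerr.
    replace (two_phase omega th a b x) with a.
    + symmetry. apply Rabs_pos_eq. assert (h := Hrange (k * x)). unfold rho. lra.
    + replace x with (x - omega + omega) by ring. rewrite two_phase_periodic by auto.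
      symmetry. apply two_phase_low; auto. fold j. lra.
  - apply (RInt_correct (V := R_CompleteNormedModule)). now apply ex_RInt_cont. }
assert (I := is_RInt_Chasles _ _ _ _ _ _ (is_RInt_Chasles _ _ _ _ _ _ I1 I2) I3).
assert (Hmean : RInt rho 0 omega = rs * omega).
{ exact (half_period_mean k omega H P Hk HK0 HkK). }
assert (EB : RInt (fun x => b - rho x) j (omega - j) = 2 * A).
{ rewrite RInt_cst_sub by auto.
  rewrite <- (RInt_split rho 0 (omega - j) omega) in Hmean by now apply ex_RInt_cont.
  rewrite <- (RInt_split rho 0 j (omega - j)) in Hmean by now apply ex_RInt_cont.
  rewrite RInt_sub_cst in EA by auto.
  assert (EA0 : A = RInt rho 0 j - a * (j - 0)) by (unfold A; rewrite RInt_sub_cst by auto; reflexivity).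
  assert (Ej : 2 * j * D = omega * (b - rs)) by (rewrite <- HthD; unfold j; field).
  unfold D in Ej. lra. }
assert (HA : A <= eta * omega / 2).
{ unfold A, rho. rewrite (RInt_congr _ (fun x => (w (k * x + 0) - a)))
    by (intros; do 2 f_equal; ring).
  rewrite (RInt_affine (fun y => w y - a) k 0); [| |lra].
  - replace (k * 0 + 0) with 0 by ring. replace (k * j + 0) with (th * K).
    + assert (h := hp_near P). fold D in h. fold th in h.
      replace (eta * omega / 2) with (/ k * (eta * K)).
      * apply Rmult_le_compat_l; auto. apply Rlt_le, Rinv_0_lt_compat. lra.
      * replace K with (k * omega / 2) by lra. field. lra.
    + unfold j. replace K with (k * omega / 2) by lra. field.
  - apply ex_RInt_cont. intros y. apply (continuous_minus (V := R_NormedModule)); auto. apply continuous_const. }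
assert (HA0 : 0 <= A).
{ apply RInt_ge_0; [lra|now apply ex_RInt_cont|]. intros x _. assert (h := Hrange (k * x)). unfold rho. lra. }
split; [eexists; exact I|].
rewrite (is_RInt_unique _ _ _ _ I), EB. unfold plus; simpl. lra.
Qed.

Lemma near_infimum (T : Type) (P : T -> Prop) (E : T -> R) (e : R) :
  (exists x, P x) -> (forall x, P x -> 0 <= E x) -> 0 < e ->
  exists x, P x /\ forall y, P y -> E x <= E y + e.
Proof.
intros [x0 Hx0] HE He.
destruct (completeness (fun r => exists x, P x /\ r = - E x)) as [M [HM1 HM2]].
- exists 0. intros r [x [Hx ->]]. specialize (HE x Hx). lra.
- exists (- E x0), x0. auto.
- apply NNPP; intros Hno.
  assert (Hle : M <= M - e); [|lra].
  apply HM2. intros r [x [Hx ->]]. apply Rnot_lt_le; intros Hlt. apply Hno.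
  exists x. split; auto. intros y Hy. assert (h := HM1 (- E y) (ex_intro _ y (conj Hy eq_refl))). lra.
Qed.

(** Smallness of [eps / omega^2] means that the rescaled half period is long. *)
Lemma half_length_large (eps omega K0 : R) :
  0 < eps -> 0 < omega -> 0 < K0 -> eps / omega ^ 2 < 1 / (2 * K0) ^ 2 ->
  K0 <= omega / (2 * sqrt eps).
Proof.
intros Heps Hom HK0 H.
assert (Hse : 0 < sqrt eps) by now apply sqrt_lt_R0.
assert (Hlt : eps < (omega / (2 * K0)) ^ 2).
{ apply (Rmult_lt_compat_r (omega ^ 2)) in H; [|nra].
  replace (eps / omega ^ 2 * omega ^ 2) with eps in H by (field; lra).
  replace ((omega / (2 * K0)) ^ 2) with (1 / (2 * K0) ^ 2 * omega ^ 2) by (field; lra). exact H. }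
assert (Hs : sqrt eps < omega / (2 * K0)).
{ rewrite <- (sqrt_pow2 (omega / (2 * K0))).
  - apply sqrt_lt_1; nra.
  - apply Rlt_le, Rdiv_lt_0_compat; lra. }
apply Rmult_le_reg_r with (2 * sqrt eps); [lra|].
replace (omega / (2 * sqrt eps) * (2 * sqrt eps)) with omega by (field; lra).
apply (Rmult_lt_compat_r (2 * K0)) in Hs; [|lra].
replace (omega / (2 * K0) * (2 * K0)) with omega in Hs by (field; lra). lra.
Qed.

(** [rho] arises from a half period by rescaling time by [sqrt eps]. *)
Definition rescaled_profile (F g : R -> R) (a b rs eps omega : R) (rho : R -> R) : Prop :=
  exists eta lam w w1,
    half_period F g a b rs (omega / (2 * sqrt eps)) eta lam w w1 /\
    rho = (fun x => w (/ sqrt eps * x)).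

(** For each [eps] a profile is taken whose [L^1] error is within [eps] of the
    least possible one; hence the error tends to 0 although the construction
    only provides, for each tolerance, some profile for all small [eps]. *)
Lemma profile_family (L : R) (F g : R -> R) (a b rs : R) :
  double_well L F g a b -> a < rs < b ->
  exists eps0, 0 < eps0 /\ forall omega, 0 < omega ->
    exists rho : R -> R -> R,
      (forall eps, 0 < eps -> eps / omega ^ 2 < eps0 ->
         rescaled_profile F g a b rs eps omega (rho eps)) /\
      two_phase_limit omega a b rho.
Proof.
intros H Hrs. assert (Hab := dw_lt H).
destruct (half_period_exists L F g a b rs 1 H Hrs ltac:(lra)) as [K0 [HK0 Hex]].
exists (1 / (2 * K0) ^ 2).
assert (Heps0 : 0 < 1 / (2 * K0) ^ 2) by (apply Rdiv_lt_0_compat; [lra|apply pow_lt; lra]).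
split; auto. intros omega Hom.
set (th := (b - rs) / (b - a)).
assert (Hth : 0 < th < 1).
{ assert (E : th * (b - a) = b - rs) by (unfold th; field; lra). split; nra. }
set (rho0 := two_phase omega th a b).
set (E := fun rho : R -> R => RInt (fun x => Rabs (rho x - rho0 x)) 0 omega).
assert (HE : forall eps rho, 0 < eps -> rescaled_profile F g a b rs eps omega rho -> 0 <= E rho).
{ intros eps rho Heps [eta [lam [w [w1 [P ->]]]]].
  apply (half_period_L1 L F g a b rs eps omega _ eta lam w w1 H Hrs P Heps Hom eq_refl). }
destruct (choice_on R (R -> R) (fun eps => 0 < eps /\ eps / omega ^ 2 < 1 / (2 * K0) ^ 2)
  (fun eps rho => rescaled_profile F g a b rs eps omega rho /\
     forall rho', rescaled_profile F g a b rs eps omega rho' -> E rho <= E rho' + eps)) as [rho Hrho].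
{ exact (inhabits (fun _ => 0)). }
{ intros eps [Heps Hsmall]. apply near_infimum; auto.
  - destruct (Hex _ (half_length_large eps omega K0 Heps Hom HK0 Hsmall)) as [lam [w [w1 P]]].
    exists (fun x => w (/ sqrt eps * x)). now exists 1, lam, w, w1.
  - intros rho. now apply HE. }
exists rho. split.
{ intros eps Heps Hsmall. apply (Hrho eps). auto. }
assert (Hom2 : 0 < omega ^ 2) by (apply pow_lt; lra).
assert (Hscale : forall eps c, eps < c * omega ^ 2 -> eps / omega ^ 2 < c).
{ intros eps c Hc. apply Rmult_lt_reg_r with (omega ^ 2); auto.
  replace (eps / omega ^ 2 * omega ^ 2) with eps by (field; lra). exact Hc. }
exists rho0. split; [|split; [|split]].
- intros x. apply two_phase_values.
- now apply two_phase_two_jumps.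
- assert (Hd : 0 < 1 / (2 * K0) ^ 2 * omega ^ 2) by now apply Rmult_lt_0_compat.
  exists (mkposreal _ Hd). intros eps Hball Heps.
  apply Rabs_lt_between in Hball. unfold minus, plus, opp in Hball; simpl in Hball.
  destruct (Hrho eps) as [[eta [lam [w [w1 [P ->]]]]] _].
  { split; auto. apply Hscale. simpl. lra. }
  apply (half_period_L1 L F g a b rs eps omega _ eta lam w w1 H Hrs P Heps Hom eq_refl).
- apply filterlim_locally. intros e. assert (He := cond_pos e).
  set (eta := e / (4 * omega)).
  assert (Heta : 0 < eta) by (apply Rdiv_lt_0_compat; lra).
  destruct (half_period_exists L F g a b rs eta H Hrs Heta) as [K1 [HK1 Hex1]].
  assert (Heps1 : 0 < 1 / (2 * K1) ^ 2) by (apply Rdiv_lt_0_compat; [lra|apply pow_lt; lra]).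
  set (d := Rmin (Rmin (1 / (2 * K0) ^ 2 * omega ^ 2) (1 / (2 * K1) ^ 2 * omega ^ 2)) (e / 2)).
  assert (Hd1 : d <= 1 / (2 * K0) ^ 2 * omega ^ 2) by (apply Rle_trans with (1 := Rmin_l _ _), Rmin_l).
  assert (Hd2 : d <= 1 / (2 * K1) ^ 2 * omega ^ 2) by (apply Rle_trans with (1 := Rmin_l _ _), Rmin_r).
  assert (Hd3 : d <= e / 2) by apply Rmin_r.
  assert (Hd : 0 < d).
  { repeat apply Rmin_glb_lt; try lra; now apply Rmult_lt_0_compat. }
  exists (mkposreal d Hd). intros eps Hball Heps.
  apply Rabs_lt_between in Hball. unfold minus, plus, opp in Hball; simpl in Hball.
  destruct (Hrho eps) as [Hp Hmin]. { split; auto. apply Hscale. lra. }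
  destruct (Hex1 _ (half_length_large eps omega K1 Heps Hom HK1 (Hscale eps (1 / (2 * K1) ^ 2) ltac:(lra))))
    as [lam [w [w1 P]]].
  assert (h1 := Hmin (fun x => w (/ sqrt eps * x)) ltac:(now exists eta, lam, w, w1)).
  assert (h2 := HE eps (rho eps) Heps Hp).
  destruct (half_period_L1 L F g a b rs eps omega _ eta lam w w1 H Hrs P Heps Hom eq_refl) as [_ h3].
  assert (h4 : 2 * eta * omega = e / 2) by (unfold eta; field; lra).
  change (Rabs (E (rho eps) - 0) < e). rewrite Rminus_0_r, Rabs_pos_eq by exact h2.
  unfold E in h1 at 2. unfold rho0 in h1. fold th in h3. lra.
Qed.

Theorem theorem3p1
  (Psi : R -> R) (rho_g rho_l m rho_gm rho_lm rho_star : R)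
  (HPsi : Ck_on 2 (fun r => 0 < r) Psi)
  (Hgl : 0 < rho_g < rho_l)
  (Hbit : strict_bitangent Psi rho_g rho_l)
  (Hglm : 0 < rho_gm < rho_lm)
  (Hbitm : strict_bitangent (Psim Psi m) rho_gm rho_lm)
  (Hm0 : m = 0 -> rho_gm = rho_g /\ rho_lm = rho_l)
  (Hstar : rho_gm < rho_star < rho_lm) :
  exists eps0 : R, 0 < eps0 /\
    (forall omega : R, 0 < omega ->
       exists rho : R -> R -> R,
         (forall eps : R, 0 < eps -> eps / omega ^ 2 < eps0 ->
            periodic_profile Psi (fun _ => 0) eps m omega rho_star rho_gm rho_lm (rho eps) /\
            (m <> 0 -> ~ is_constant (velocity m (rho eps)))) /\
         two_phase_limit omega rho_gm rho_lm rho) /\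
    (m = 0 ->
     forall mu : R -> R, (forall r, 0 < r -> 0 < mu r) ->
     forall omega : R, 0 < omega ->
       exists rho : R -> R -> R,
         (forall eps : R, 0 < eps -> eps / omega ^ 2 < eps0 ->
            periodic_profile Psi mu eps m omega rho_star rho_gm rho_lm (rho eps) /\
            is_constant (velocity m (rho eps))) /\
         two_phase_limit omega rho_gm rho_lm rho).
Proof.
destruct (bitangent_double_well Psi m rho_gm rho_lm HPsi Hglm Hbitm) as [L [F [beta H]]].
set (g := fun r => Psim1 Psi m (clamp rho_gm rho_lm r) - beta) in *.
assert (Hprof : forall mu eps omega rho, 0 < eps -> 0 < omega ->
   rescaled_profile F g rho_gm rho_lm rho_star eps omega rho ->
   (m = 0 \/ forall r, mu r = 0) ->
   periodic_profile Psi mu eps m omega rho_star rho_gm rho_lm rho).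
{ intros mu eps omega rho Heps Hom [eta [lam [w [w1 [P ->]]]]] Hmu.
  apply (half_period_profile Psi mu L F beta rho_gm rho_lm m rho_star eps omega _ eta lam w w1 HPsi
    (proj1 Hglm) H P Heps Hom eq_refl Hmu). }
destruct (profile_family L F g rho_gm rho_lm rho_star H Hstar) as [eps0 [Heps0 Hfam]].
exists eps0. split; [exact Heps0|split].
- intros omega Hom. destruct (Hfam omega Hom) as [rho [Hrho Hlim]].
  exists rho. split; [|exact Hlim]. intros eps Heps Hsmall.
  assert (HP := Hprof (fun _ => 0) eps omega (rho eps) Heps Hom (Hrho eps Heps Hsmall)
    (or_intror (fun _ => eq_refl))).
  split; [exact HP|]. intros Hm [c Hc].
  destruct HP as [[_ [Hpos _]] [_ [Hnc _]]]. apply Hnc.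
  exists (m / c). intros x. rewrite <- (Hc x). unfold velocity.
  assert (h := Hpos x). field. lra.
- intros Hm mu _ omega Hom. destruct (Hfam omega Hom) as [rho [Hrho Hlim]].
  exists rho. split; [|exact Hlim]. intros eps Heps Hsmall. split.
  + apply Hprof; auto.
  + exists 0. intros x. unfold velocity. rewrite Hm. unfold Rdiv. ring.
Qed.
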